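(* With $\mathcal U^{s,t}:=\{f\in\Omega:\ -f(-t)\ge b+c_2t,\ f(-s)-f(-t)\ge b+c_2t-c_1s\}$, $$J\ \ge\ \inf_{t>t_0}\ \sup_{s\in(0,t)}\ \inf_{f\in\mathcal U^{s,t}}I(f).$$
   Context: Let $v:[0,\infty)\to[0,\infty)$ be continuous with $v(0)=0$ and $\lim_{t\to\infty}v(t)/t^{\alpha}=0$ for some $\alpha<2$. Let $A=(A(t))_{t\in\mathbb R}$ be a centered Gaussian process with continuous sample paths, $A(0)=0$, stationary increments and $\mathrm{Var}(A(t)-A(s))=v(|t-s|)$; write $A(s,t):=A(t)-A(s)$ and $\Gamma(s,t):=\tfrac12\big(v(|s|)+v(|t|)-v(|t-s|)\big)$ for $s,t\in\mathbb R$. Let $A_1,A_2,\dots$ be i.i.d. copies of $A$. $\Omega$ is the set of continuous $\omega:\mathbb R\to\mathbb R$ with $\omega(0)=0$ and $\omega(t)/(1+|t|)\to0$ as $t\to\pm\infty$, normed by $\|\omega\|_\Omega:=\sup_t|\omega(t)|/(1+|t|)$. $R\subseteq\Omega$ is the reproducing kernel Hilbert space of $\Gamma$ (closure of the span of $\{\Gamma(s,\cdot)\}$ under $\langle\Gamma(s,\cdot),\Gamma(u,\cdot)\rangle_R=\Gamma(s,u)$), and $I(\omega):=\frac12\|\omega\|_R^2$ for $\omega\in R$, $I(\omega):=\infty$ otherwise. Fix $b>0$, $c_1>c_2>0$, $t_0:=b/(c_1-c_2)$, let $$Q_{2,n}:=\sup_{t>0}\Big(\sum_{i=1}^nA_i(-t,0)-nc_2t\Big)-\sup_{s>0}\Big(\sum_{i=1}^nA_i(-s,0)-nc_1s\Big),$$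 and $J:=-\lim_{n\to\infty}\frac1n\log\mathbb P(Q_{2,n}>nb)$ (this limit exists). *)

(* Defs.v *)
From HB Require Import structures.
From mathcomp Require Import all_boot all_order all_algebra.
From mathcomp Require Import all_classical all_reals all_analysis.
Set Implicit Arguments. Unset Strict Implicit. Unset Printing Implicit Defensive.
Import Order.TTheory GRing.Theory Num.Theory.
Import numFieldNormedType.Exports.
Local Open Scope classical_set_scope.
Local Open Scope ring_scope.

Section Defs.
Context {R : realType}.

Definition Gam (v : R -> R) (s t : R) : R :=
  (v `|s| + v `|t| - v `|t - s|) / 2.

Definition centered_normal_law (s2 : R) : set R -> \bar R :=
  if s2 == 0 then (\d_(0:R) : set R -> \bar R)
  else normal_prob 0 (Num.sqrt s2).

Definition centered_gaussian_family {d} {T : measurableType d} (P : probability T R)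
  (I : Type) (X : I -> T -> R) (K : I -> I -> R) : Prop :=
  (forall i, measurable_fun setT (X i)) /\
  forall (cs : seq (R * I)) (B : set R), measurable B ->
    P ((fun w => \sum_(p <- cs) p.1 * X p.2 w) @^-1` B) =
    centered_normal_law (\sum_(p <- cs) \sum_(q <- cs) p.1 * q.1 * K p.2 q.2) B.

(* A_i (i : nat) are i.i.d. copies of a centered Gaussian process with continuous
   paths, A(0) = 0 and covariance Gamma: the joint family (A_i(t))_{i,t} is centered
   Gaussian with Cov(A_i(s), A_j(t)) = [i = j] Gamma(s,t). *)
Definition iid_gaussian_copies {d} {T : measurableType d} (P : probability T R)
  (v : R -> R) (A : nat -> R -> T -> R) : Prop :=
  centered_gaussian_family P (fun it : nat * R => A it.1 it.2)
     (fun it ju => if it.1 == ju.1 then Gam v it.2 ju.2 else 0) /\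
  (forall i w, continuous (fun t => A i t w)) /\
  (forall i w, A i 0 w = 0).

Definition supnet (A : nat -> R -> R) (n : nat) (c : R) : \bar R :=
  ereal_sup [set (\sum_(i < n) (A i 0 - A i (- t)) - n%:R * c * t)%:E
            | t in `]0, +oo[%classic].

Definition Q2 {T : Type} (A : nat -> R -> T -> R) (n : nat) (c1 c2 : R) (w : T)
  : \bar R :=
  (supnet (fun i t => A i t w) n c2 - supnet (fun i t => A i t w) n c1)%E.

Definition elog (x : \bar R) : \bar R :=
  match x with
  | r%:E => if (0 < r)%R then (ln r)%:E else -oo
  | +oo => +oo
  | -oo => -oo
  end%E.

Definition in_Omega (f : R -> R) : Prop :=
  continuous f /\ f 0 = 0 /\
  (fun t => f t / (1 + `|t|)) @ +oo --> 0 /\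
  (fun t => f t / (1 + `|t|)) @ -oo --> 0.

(* elements of span{Gamma(s,.)} as finite lists of (coefficient, s) *)
Definition span_eval (v : R -> R) (h : seq (R * R)) (x : R) : R :=
  \sum_(p <- h) p.1 * Gam v p.2 x.

Definition span_norm2 (v : R -> R) (h : seq (R * R)) : R :=
  \sum_(p <- h) \sum_(q <- h) p.1 * q.1 * Gam v p.2 q.2.

Definition span_sub (h g : seq (R * R)) : seq (R * R) :=
  h ++ [seq (- q.1, q.2) | q <- g].

(* x = ||f||_R^2 witnessed by a ||.||_R-Cauchy sequence in the span converging
   (hence pointwise) to f *)
Definition rkhs_norm2_of (v : R -> R) (f : R -> R) (x : R) : Prop :=
  exists h : nat -> seq (R * R),
    (forall e : R, 0 < e -> exists N : nat, forall m n : nat, (N <= m)%N -> (N <= n)%N ->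
        span_norm2 v (span_sub (h m) (h n)) < e) /\
    (forall t, (fun n => span_eval v (h n) t) @ \oo --> f t) /\
    ((fun n => span_norm2 v (h n)) @ \oo --> x).

(* I(f) = ||f||_R^2 / 2 if f in R, +oo otherwise *)
Definition rate (v : R -> R) (f : R -> R) : \bar R :=
  ereal_inf [set (x / 2)%:E | x in rkhs_norm2_of v f].

Definition Ust (b c1 c2 s t : R) : set (R -> R) :=
  [set f | in_Omega f /\ b + c2 * t <= - f (- t) /\
           b + c2 * t - c1 * s <= f (- s) - f (- t)].

End Defs.

(* Main.v *)
(* Write [S_n(t) = sum_i A_i(-t, 0)].  If the event occurs, then for some [t > t0]
   [S_n(t) - S_n(s) >= n (b + c2 t - c1 s)] for all [s >= 0].  For a fixed pair [(s, t)] a Chernoff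
   bound on a nonnegative combination of the constraints at [0] and [s] costs [exp(- n M)] as soon as
   the dual quadratic program of [inf I] over [U^{s,t}] exceeds [M]; planar quadratic duality
   identifies the two values, minimizers being combinations of [Gamma(-t, .)] and [Gamma(-s, .)].
   A union bound over [t] is made finite by compactness of [[t0, k0]]: the oscillation of [S_n] near
   [t] and its growth beyond [k0] are super-exponentially small by Fernique's argument, which rests
   on the rotation invariance of two independent copies.  Joint laws are accessed from the laws of
   linear combinations only, through a Cramer-Wold argument: indicators of boxes are bounded
   pointwise limits of polynomials in cosines of the coordinates.  The endpoint [t = t0], excluded
   from the infimum, is treated by shifting and rescaling almost-optimal paths. *)

Require Import Defs.
From mathcomp Require Import all_boot all_order all_algebra finmap.
From mathcomp Require Import all_classical all_reals all_analysis.
From mathcomp Require Import measurable_realfun.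
From mathcomp Require Import ring lra.
Import Order.TTheory GRing.Theory Num.Theory.
Import numFieldNormedType.Exports.
Local Open Scope classical_set_scope.
Local Open Scope ring_scope.

(** * Normal laws *)

(** The hypothesis gives one-dimensional centered laws only. Everything is therefore kept even:
    cosines stand for complex characteristic functions and symmetric boxes for general events. The
    cosine transform of a normal law is never evaluated: since it depends on the variance alone, box
    probabilities are functions of covariances, and since it is multiplicative in the variance,
    uncorrelated families are independent. No supremum over a continuum of times is estimated: all
    bounds concern finitely many times, are uniform in their number, and reach the overflow event
    through rational times and continuity of measure. Fernique's argument fits because its only
    input is a level that a single copy exceeds with small probability, which path continuity
    supplies. The factor in front of [exp(- n M)] may be any constant independent of [n], since it
    disappears after taking [log] and dividing by [n]. *)

Section density.
Context d (T : measurableType d) (R : realType).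
Variables (mu nu : {measure set T -> \bar R}) (p : T -> R).
Hypotheses (mp : measurable_fun setT p) (p0 : forall x, 0 <= p x)
  (nuE : forall A, measurable A -> nu A = (\int[mu]_(x in A) (p x)%:E)%E).
Local Open Scope ereal_scope.
Import HBNNSimple.

Let mpe : measurable_fun setT (fun x => (p x)%:E).
Proof. exact/measurable_EFinP. Qed.

Let integral_density_nnsfun (f : {nnsfun T >-> R}) :
  \int[nu]_x (f x)%:E = \int[mu]_x ((f x)%:E * (p x)%:E).
Proof.
under [LHS]eq_integral do rewrite fimfunE -fsumEFin//.
rewrite [LHS]ge0_integral_fsum//; last 2 first.
  - by move=> r; exact/measurable_EFinP/measurableT_comp.
  - by move=> n x _; rewrite EFinM nnfun_muleindic_ge0.
under [RHS]eq_integral.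
  move=> x xD; rewrite fimfunE -fsumEFin// ge0_mule_fsuml; last first.
    by move=> r; rewrite EFinM nnfun_muleindic_ge0.
  over.
rewrite [RHS]ge0_integral_fsum//; last 2 first.
  - move=> r; apply: emeasurable_funM => //.
    by apply/measurable_EFinP; do 2 apply/measurableT_comp => //.
  - move=> n x _; rewrite mule_ge0 ?lee_fin//.
    by have := nnfun_muleindic_ge0 f n x; rewrite -EFinM lee_fin.
apply: eq_fsbigr => r _.
have [r0|r0] := leP 0%R r; last first.
  rewrite !integral0_eq// => x _; rewrite preimage_nnfun0// indicE in_set0 mulr0//.
  by rewrite mul0e.
rewrite integralZl_indic_nnsfun//= integral_indic// setIT nuE//.
under [RHS]eq_integral do rewrite EFinM -muleA.
rewrite ge0_integralZl//; last 2 first.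
  - apply: emeasurable_funM => //.
    by apply/measurable_EFinP; exact: measurable_indic.
  - by move=> x _; rewrite mule_ge0// lee_fin.
congr (_ * _).
rewrite [LHS]integral_mkcond; apply: eq_integral => x _.
rewrite patchE indicE; case: ifPn => xA; first by rewrite mul1e.
by rewrite mul0e.
Qed.

Lemma ge0_integral_density (f : T -> \bar R) :
  measurable_fun setT f -> (forall x, 0 <= f x) ->
  \int[nu]_x f x = \int[mu]_x (f x * (p x)%:E).
Proof.
move=> mf f0.
pose f_ := nnsfun_approx measurableT mf.
transitivity (lim (\int[nu]_x (f_ n x)%:E @[n --> \oo])).
  rewrite -monotone_convergence//=.
  - apply: eq_integral => ? /[!inE] xD; apply/esym/cvg_lim => //=.
    exact: cvg_nnsfun_approx.
  - by move=> n; exact/measurable_EFinP/measurable_funTS.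
  - by move=> n ? _; rewrite lee_fin.
  - by move=> ? _ ? ? mn; rewrite lee_fin; exact/lefP/nd_nnsfun_approx.
transitivity (lim (\int[mu]_x ((f_ n x)%:E * (p x)%:E) @[n --> \oo])).
  by apply: congr_lim; apply/funext => n /=; exact: integral_density_nnsfun.
rewrite -monotone_convergence//=.
- apply: eq_integral => x _; apply/cvg_lim => //=.
  by apply: cvgeZr => //; exact: cvg_nnsfun_approx.
- move=> n; apply: emeasurable_funM => //.
  exact/measurable_EFinP/measurable_funTS.
- by move=> n ? _; rewrite mule_ge0// lee_fin.
- by move=> ? _ ? ? mn; rewrite lee_wpmul2r ?lee_fin//; exact/lefP/nd_nnsfun_approx.
Qed.

End density.

Section normal.
Context {R : realType}.
Implicit Types s x y z : R.
Notation mu := (@lebesgue_measure R).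

(** On [[x, +oo[] the factor [exp(y - x)] is at least 1, and the centered density times [exp y] is
    [exp(s^2 / 2)] times the normal density with mean [s^2]. Slopes other than 1 are obtained by
    scaling the variable. *)
Lemma normal_prob_mgf s x : s != 0 ->
  (normal_prob 0 s `[x, +oo[%classic <= (expR (- x + s ^+ 2 / 2))%:E)%E.
Proof.
move=> s0; rewrite /normal_prob.
have s20 : s ^+ 2 != 0 by rewrite sqrf_eq0.
pose g y := expR (- x + s ^+ 2 / 2) * normal_pdf (s ^+ 2) s y.
have mg : measurable_fun setT (fun x => (g x)%:E).
  by apply/measurable_EFinP; apply: measurable_funM => //; exact: measurable_normal_pdf.
apply: (@le_trans _ _ (\int[mu]_(y in `[x, +oo[) (g y)%:E)%E).
  apply: ge0_le_integral => //=.
  - by move=> y _; rewrite lee_fin normal_pdf_ge0.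
  - by apply/measurable_EFinP/measurable_funTS; exact: measurable_normal_pdf.
  - exact: measurable_funTS mg.
  - move=> y; rewrite in_itv/= andbT => xy; rewrite lee_fin /g !normal_pdfE//.
    rewrite /normal_fun mulrCA ler_pM2l ?normal_peak_gt0// -expRD ler_expR.
    have -> : - (y - s ^+ 2) ^+ 2 / (s ^+ 2 *+ 2) =
       - (y - 0) ^+ 2 / (s ^+ 2 *+ 2) + y - s ^+ 2 / 2 by field.
    lra.
apply: (@le_trans _ _ (\int[mu]_y (g y)%:E)%E).
  apply: ge0_subset_integral => //=.
  by move=> y _; rewrite lee_fin /g mulr_ge0 ?expR_ge0 ?normal_pdf_ge0.
under eq_integral do rewrite /g EFinM.
rewrite ge0_integralZl//=.
- by rewrite integral_normal_pdf mule1.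
- by apply/measurable_EFinP; exact: measurable_normal_pdf.
- by move=> y _; rewrite lee_fin normal_pdf_ge0.
Qed.

Lemma integral_shift (G : R -> R) (c : R) :
  continuous G -> (forall x, 0 <= G x) ->
  (\int[mu]_x (G x)%:E = \int[mu]_x (G (x + c))%:E)%E.
Proof.
move=> cG G0.
have F'E : (fun x : R => x + c)^`()%classic = cst 1.
  by apply/funext => x; rewrite derive1E deriveD// derive_id derive_cst addr0.
rewrite (@increasing_ge0_integration_by_substitutionT _ (fun x => x + c))//.
- by apply: eq_integral => x _; rewrite F'E /= fctE/= mulr1.
- by move=> x y xy; rewrite ltrD2r.
- by rewrite F'E => x; exact: cvg_cst.
- by rewrite F'E; exact: is_cvg_cst.
- by rewrite F'E; exact: is_cvg_cst.
- exact: cvg_addrr_Ny.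
- exact: cvg_addrr.
Qed.

End normal.

(** * Cosine transform of centered normal laws *)

Section normal_cos.
Context {R : realType}.
Implicit Types s x y z : R.
Notation mu := (@lebesgue_measure R).

(** Bayes' formula: for [z = e x + y] with independent normal [x] and [y], the joint density is the
    density of [z] times the conditional density of [x] given [z]. The sign [e] treats sum and
    difference at once. *)
Lemma normal_pdf_mul (e s t r x z : R) : e ^+ 2 = 1 -> 0 < s -> 0 < t -> 0 < r ->
  r ^+ 2 = s ^+ 2 + t ^+ 2 ->
  normal_pdf 0 s x * normal_pdf 0 t (z - e * x) =
  normal_pdf 0 r z * normal_pdf (e * s ^+ 2 * z / r ^+ 2) (s * t / r) x.
Proof.
move=> e2 s0 t0 r0 r2.
have sn0 : s != 0 by rewrite gt_eqF.
have tn0 : t != 0 by rewrite gt_eqF.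
have rn0 : r != 0 by rewrite gt_eqF.
have strn0 : s * t / r != 0 by rewrite gt_eqF// divr_gt0// mulr_gt0.
rewrite !normal_pdfE// /normal_fun mulrACA [RHS]mulrACA -!expRD; congr (_ * expR _).
  rewrite /normal_peak -!invfM -!sqrtrM; last 2 first.
  - by rewrite mulrn_wge0// mulr_ge0 ?sqr_ge0 ?pi_ge0.
  - by rewrite mulrn_wge0// mulr_ge0 ?sqr_ge0 ?pi_ge0.
  by congr (Num.sqrt _)^-1; field.
have -> : e * s ^+ 2 * z / r ^+ 2 = e * (s ^+ 2 * z / r ^+ 2) by ring.
set m := s ^+ 2 * z / r ^+ 2.
have -> : (z - e * x - 0) ^+ 2 = z ^+ 2 - 2 * z * (e * x) + x ^+ 2.
  transitivity (z ^+ 2 - 2 * z * (e * x) + e ^+ 2 * x ^+ 2); first ring.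
  by rewrite e2 mul1r.
have -> : (x - e * m) ^+ 2 = x ^+ 2 - 2 * (e * x) * m + m ^+ 2.
  transitivity (x ^+ 2 - 2 * (e * x) * m + e ^+ 2 * m ^+ 2); first ring.
  by rewrite e2 mul1r.
have -> : (s * t / r) ^+ 2 = s ^+ 2 * t ^+ 2 / r ^+ 2 by field.
have u0 : s ^+ 2 != 0 by rewrite expf_neq0.
have v0 : t ^+ 2 != 0 by rewrite expf_neq0.
have w0 : r ^+ 2 != 0 by rewrite expf_neq0.
rewrite /m; move: (e * x) => k; rewrite r2 in w0 *.
move: (s ^+ 2) (t ^+ 2) u0 v0 w0 => u v u0 v0 w0.
by field; rewrite u0 v0 w0.
Qed.

Let c1 x : 0 <= 1 + cos x.
Proof. by have := cos_geN1 x; lra. Qed.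

Let mcos1 : measurable_fun setT (fun x : R => 1 + cos x).
Proof.
apply: measurable_funD => //.
by apply: continuous_measurable_fun; exact: continuous_cos.
Qed.

(** The 1 added to the cosine makes the integrand nonnegative, so that Tonelli applies. After the
    substitution [y = z - e x] the integral in [x] is that of a conditional density, hence 1. *)
Lemma normal_cos_conv (e s t r : R) : e ^+ 2 = 1 -> 0 < s -> 0 < t -> 0 < r ->
  r ^+ 2 = s ^+ 2 + t ^+ 2 ->
  (\int[mu]_x \int[mu]_y ((1 + cos (e * x + y)) * (normal_pdf 0 s x * normal_pdf 0 t y))%:E =
   \int[mu]_z ((1 + cos z) * normal_pdf 0 r z)%:E)%E.
Proof.
move=> e2 s0 t0 r0 r2.
have sn0 : s != 0 by rewrite gt_eqF.
have tn0 : t != 0 by rewrite gt_eqF.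
have rn0 : r != 0 by rewrite gt_eqF.
pose f (w : R * R) := (((1 + cos w.2) * (normal_pdf 0 s w.1 * normal_pdf 0 t (w.2 - e * w.1)))%:E)%E.
transitivity (\int[mu]_x \int[mu]_z f (x, z))%E.
  apply: eq_integral => x _.
  rewrite (@integral_shift _ _ (- (e * x))).
  - apply: eq_integral => z _; rewrite /f /=.
    by have -> : e * x + (z - e * x) = z by ring.
  - move=> y; apply: (@cvgM R^o).
      apply: (@cvgD _ R^o); first exact: cvg_cst.
      apply: (cvg_comp _ cos); last exact: continuous_cos.
      by apply: (@cvgD _ R^o); [exact: cvg_cst|exact: cvg_id].
    by apply: (@cvgM R^o); [exact: cvg_cst|exact: continuous_normal_pdf].
  - by move=> y; rewrite !mulr_ge0 ?normal_pdf_ge0.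
have mf : measurable_fun setT f.
  apply/measurable_EFinP; apply: measurable_funM.
    by apply: (measurableT_comp mcos1); exact: measurable_snd.
  apply: measurable_funM.
    by apply: (measurableT_comp (measurable_normal_pdf _ _)); exact: measurable_fst.
  apply: (measurableT_comp (measurable_normal_pdf _ _)).
  apply: measurable_funB; first exact: measurable_snd.
  by apply: measurable_funM => //; exact: measurable_fst.
have f0 w : (0 <= f w)%E by rewrite lee_fin !mulr_ge0 ?normal_pdf_ge0.
rewrite -[LHS](@fubini_tonelli1 _ _ _ _ _ mu mu f mf f0) (@fubini_tonelli2 _ _ _ _ _ mu mu f mf f0).
apply: eq_integral => z _; rewrite /fubini_G /f /=.
under eq_integral do rewrite (@normal_pdf_mul _ _ _ r)// mulrA EFinM.
rewrite ge0_integralZl//=.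
- by rewrite integral_normal_pdf mule1.
- by apply/measurable_EFinP; exact: measurable_normal_pdf.
- by move=> x _; rewrite lee_fin normal_pdf_ge0.
- by rewrite lee_fin mulr_ge0 ?normal_pdf_ge0.
Qed.

(** The characteristic function at frequency 1 of the centered law of variance [s2], as a function
    of the variance; other frequencies amount to other variances. Variance 0 is the Dirac mass and
    has no density. *)
Definition normal_charfun (s2 : R) : R :=
  if s2 == 0 then 1 else \int[mu]_x (cos x * normal_pdf 0 (Num.sqrt s2) x).

Lemma integrable_cos_normal s : s != 0 ->
  mu.-integrable setT (EFin \o (fun x => cos x * normal_pdf 0 s x)).
Proof.
move=> s0; apply: (le_integrable measurableT _ _ (integrable_normal_pdf 0 s)).
  apply/measurable_EFinP; apply: measurable_funM; last exact: measurable_normal_pdf.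
  by apply: continuous_measurable_fun; exact: continuous_cos.
move=> x _; rewrite lee_fin normrM ler_piMl//.
by rewrite ler_norml cos_geN1 cos_le1.
Qed.

Let cos1E s c : s != 0 -> -1 <= c <= 1 ->
  (\int[mu]_x ((1 + c * cos x) * normal_pdf 0 s x)%:E =
  (1 + c * \int[mu]_x (cos x * normal_pdf 0 s x))%:E)%E.
Proof.
move=> s0 c11.
under eq_integral do rewrite mulrDl mul1r -mulrA EFinD EFinM.
have i1 := integrable_normal_pdf (0 : R) s.
have i2 := integrable_cos_normal s s0.
rewrite integralD//=; last by apply: integrableZl.
rewrite integral_normal_pdf integralZl// EFinD EFinM; congr (_ + (_ * _))%E.
by rewrite /Rintegral fineK//; exact: integrable_fin_num.
Qed.

(** [cos x cos y] is the average of [cos (x + y)] and [cos (y - x)], and for independent [x], [y]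
    both arguments are normal of variance [s + t]. *)
Lemma normal_charfunD s t : 0 <= s -> 0 <= t ->
  normal_charfun (s + t) = normal_charfun s * normal_charfun t.
Proof.
rewrite le_eqVlt => /predU1P[<- _|s0].
  by rewrite add0r /normal_charfun eqxx mul1r.
rewrite le_eqVlt => /predU1P[<-|t0].
  by rewrite addr0 /normal_charfun eqxx mulr1.
rewrite /normal_charfun !gt_eqF ?addr_gt0//.
set S := Num.sqrt s; set U := Num.sqrt t; set V := Num.sqrt (s + t).
have S0 : 0 < S by rewrite sqrtr_gt0.
have U0 : 0 < U by rewrite sqrtr_gt0.
have V0 : 0 < V by rewrite sqrtr_gt0 addr_gt0.
have V2 : V ^+ 2 = S ^+ 2 + U ^+ 2 by rewrite !sqr_sqrtr// ltW// addr_gt0.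
have Sn0 : S != 0 by rewrite gt_eqF.
have Un0 : U != 0 by rewrite gt_eqF.
have Vn0 : V != 0 by rewrite gt_eqF.
pose g e x y := (1 + cos (e * x + y)) * (normal_pdf 0 S x * normal_pdf 0 U y).
have mg e : measurable_fun setT (fun w : R * R => (g e w.1 w.2)%:E).
  apply/measurable_EFinP; apply: measurable_funM.
    apply: (measurableT_comp mcos1); apply: measurable_funD; last exact: measurable_snd.
    by apply: measurable_funM => //; exact: measurable_fst.
  by apply: measurable_funM; apply: (measurableT_comp (measurable_normal_pdf _ _));
    [exact: measurable_fst|exact: measurable_snd].
have g0 e x y : (0 <= (g e x y)%:E)%E by rewrite lee_fin !mulr_ge0 ?normal_pdf_ge0.
have E1 := @normal_cos_conv 1 S U V (expr1n _ _) S0 U0 V0 V2.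
have E2 : (\int[mu]_x \int[mu]_y (g (-1) x y)%:E =
   \int[mu]_z ((1 + cos z) * normal_pdf 0 V z)%:E)%E.
  by apply: normal_cos_conv => //; rewrite sqrrN expr1n.
have sumE : (\int[mu]_x \int[mu]_y (g 1 x y)%:E + \int[mu]_x \int[mu]_y (g (-1) x y)%:E =
  \int[mu]_x (\int[mu]_y ((1 + cos x * cos y) * normal_pdf 0 U y)%:E * (2 * normal_pdf 0 S x)%:E))%E.
  rewrite -ge0_integralD//=; last 4 first.
  - by move=> x _; apply: integral_ge0.
  - exact: (@measurable_fun_fubini_tonelli_F _ _ _ _ _ mu _ (mg 1) (fun w => g0 _ w.1 w.2)).
  - by move=> x _; apply: integral_ge0.
  - exact: (@measurable_fun_fubini_tonelli_F _ _ _ _ _ mu _ (mg (-1)) (fun w => g0 _ w.1 w.2)).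
  apply: eq_integral => x _.
  have mgx e : measurable_fun setT (fun y => (g e x y)%:E).
    exact: (measurableT_comp (mg e) (measurable_pair1 x)).
  rewrite -ge0_integralD//=; [|exact: mgx..].
  rewrite -[RHS]ge0_integralZr//=; last 3 first.
  - apply/measurable_EFinP; apply: measurable_funM; last exact: measurable_normal_pdf.
    apply: measurable_funD => //; apply: measurable_funM => //.
    by apply: continuous_measurable_fun; exact: continuous_cos.
  - move=> y _; rewrite lee_fin; apply: mulr_ge0; last exact: normal_pdf_ge0.
    have : `|cos x * cos y| <= 1.
      by rewrite normrM mulr_ile1// ler_norml cos_geN1 cos_le1.
    by rewrite ler_norml; lra.
  - by rewrite lee_fin mulr_ge0 ?normal_pdf_ge0.
  apply: eq_integral => y _; rewrite -EFinD -EFinM; congr EFin.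
  rewrite /g mul1r mulN1r !cosD cosN sinN; ring.
move: sumE; rewrite E2 E1.
under [X in _ = X -> _]eq_integral => x _.
  rewrite cos1E//; last by rewrite cos_geN1 cos_le1.
  rewrite -EFinM.
  set F := \int[mu]_x0 _.
  have -> : (1 + cos x * F) * (2 * normal_pdf 0 S x) = 2 * ((1 + F * cos x) * normal_pdf 0 S x) by ring.
  rewrite EFinM; over.
have FU : -1 <= \int[mu]_x (cos x * normal_pdf 0 U x) <= 1.
  rewrite -ler_norml; apply: le_trans (le_normr_Rintegral _ _) _ => //.
    exact: integrable_cos_normal.
  have -> : 1 = \int[mu]_x (normal_pdf 0 U x) by rewrite /Rintegral integral_normal_pdf.
  apply: le_Rintegral => //.
  - have /integrable_norm := integrable_cos_normal _ Un0; exact.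
  - exact: integrable_normal_pdf.
  - move=> x _; rewrite normrM (ger0_norm (normal_pdf_ge0 _ _ _)) ler_piMl ?normal_pdf_ge0//.
    by rewrite ler_norml cos_geN1 cos_le1.
rewrite integralZl//; last first.
  under eq_fun do rewrite mulrDl mul1r -mulrA EFinD EFinM.
  apply: integrableD => //; first exact: integrable_normal_pdf.
  apply: integrableZl => //; exact: integrable_cos_normal.
rewrite cos1E//.
have := cos1E V 1 Vn0; under eq_integral do rewrite mul1r.
rewrite mul1r => ->; last by rewrite lexx (le_trans (lerN10 _) ler01).
rewrite -EFinD -EFinM => -[].
move: (\int[mu]_x (cos x * normal_pdf 0 V x)) (\int[mu]_x (cos x * normal_pdf 0 U x))
  (\int[mu]_x (cos x * normal_pdf 0 S x)) => a b c E.
by lra.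
Qed.

End normal_cos.

Section bounded_integral.
Context {d} {T : measurableType d} {R : realType} (P : probability T R).

Definition bounded_mfun (f : T -> R) :=
  measurable_fun setT f /\ exists C : R, forall w, `|f w| <= C.

Lemma bounded_mfun_integrable f : bounded_mfun f -> P.-integrable setT (EFin \o f).
Proof.
move=> [mf [C fC]]; apply: measurable_bounded_integrable => //.
  by rewrite -[X in (X < _)%E]/(P setT) probability_setT ltry.
exists C; split; first by rewrite num_real.
by move=> M CM w _; exact: le_trans (fC w) (ltW CM).
Qed.

Lemma bounded_mfun_cst c : bounded_mfun (fun=> c).
Proof. by split => //; exists `|c|. Qed.

Lemma bounded_mfunM f g : bounded_mfun f -> bounded_mfun g ->
  bounded_mfun (fun w => f w * g w).
Proof.
move=> [mf [C fC]] [mg [D gD]]; split; first exact: measurable_funM.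
by exists (C * D) => w; rewrite normrM ler_pM.
Qed.

Lemma bounded_mfunB f g : bounded_mfun f -> bounded_mfun g ->
  bounded_mfun (fun w => f w - g w).
Proof.
move=> [mf [C fC]] [mg [D gD]]; split; first exact: measurable_funB.
by exists (C + D) => w; rewrite (le_trans (ler_normB _ _))// lerD.
Qed.

Lemma bounded_mfunD f g : bounded_mfun f -> bounded_mfun g ->
  bounded_mfun (fun w => f w + g w).
Proof.
move=> [mf [C fC]] [mg [D gD]]; split; first exact: measurable_funD.
by exists (C + D) => w; rewrite (le_trans (ler_normD _ _))// lerD.
Qed.

Lemma bounded_mfun_cos f : measurable_fun setT f -> bounded_mfun (fun w => cos (f w)).
Proof.
move=> mf; split.
  apply: measurableT_comp mf.
  by apply: continuous_measurable_fun; exact: continuous_cos.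
by exists 1 => w; rewrite ler_norml cos_geN1 cos_le1.
Qed.

Lemma bounded_mfun_indic (A : set T) : measurable A -> bounded_mfun (\1_A).
Proof.
move=> mA; split; first exact: measurable_indic.
by exists 1 => w; rewrite indicE normr_nat lern1 leq_b1.
Qed.

Lemma Rintegral_bounded_cvg (f_ : nat -> T -> R) (f : T -> R) (C : R) :
  (forall n, measurable_fun setT (f_ n)) -> measurable_fun setT f ->
  (forall n w, `|f_ n w| <= C) -> (forall w, f_ n w @[n --> \oo] --> f w) ->
  \int[P]_w f_ n w @[n --> \oo] --> \int[P]_w f w.
Proof.
move=> mf_ mf fC ff.
have [] := @dominated_convergence _ _ _ P _ measurableT (fun n w => (f_ n w)%:E)
  (EFin \o f) (cst C%:E).
- by move=> n; exact/measurable_EFinP.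
- exact/measurable_EFinP.
- by apply: aeW => w _ /=; apply/fine_cvgP; split; [exact: nearW|exact: ff].
- by have := bounded_mfun_integrable _ (bounded_mfun_cst C).
- by apply: aeW => w n _ /=; rewrite lee_fin.
move=> if_ _ h; rewrite /Rintegral; apply: fine_cvg => /=.
by rewrite fineK//; exact: integrable_fin_num.
Qed.

Lemma Rintegral_indic (A : set T) : measurable A -> \int[P]_w \1_A w = fine (P A).
Proof. by move=> mA; rewrite /Rintegral integral_indic// setIT. Qed.

End bounded_integral.

Lemma ge0_integral_law {d d'} {T : measurableType d} {Y : measurableType d'} {R : realType}
    (P : {measure set T -> \bar R}) (nu : {measure set Y -> \bar R}) (X : T -> Y)
    (mX : measurable_fun setT X) (f : Y -> \bar R) :
  (forall B, measurable B -> P (X @^-1` B) = nu B) ->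
  measurable_fun setT f -> (forall y, 0 <= f y)%E ->
  (\int[P]_w f (X w) = \int[nu]_y f y)%E.
Proof.
move=> lawX mf f0.
rewrite -[LHS](ge0_integral_pushforward mX P measurableT mf)//.
by apply: eq_measure_integral => B mB _; exact: lawX.
Qed.

Section normal_law.
Context {d} {T : measurableType d} {R : realType} (P : probability T R).
Variables (X : T -> R) (s2 : R).
Hypothesis mX : measurable_fun setT X.
Hypothesis lawX : forall B, measurable B -> P (X @^-1` B) = centered_normal_law s2 B.

Lemma normal_law_cos : 0 <= s2 -> \int[P]_w cos (X w) = normal_charfun s2.
Proof.
move=> s20.
have mc : measurable_fun setT (fun y : R => (1 + cos y)%:E).
  apply/measurable_EFinP; apply: measurable_funD => //.
  by apply: continuous_measurable_fun; exact: continuous_cos.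
have c0 y : (0 <= (1 + cos y : R)%:E)%E.
  by rewrite lee_fin; have := cos_geN1 y; lra.
have E1 : (\int[P]_w (1 + cos (X w))%:E = (1 + \int[P]_w cos (X w))%:E)%E.
  have i := bounded_mfun_integrable P _ (bounded_mfun_cos _ mX).
  under eq_integral do rewrite EFinD.
  rewrite integralD//; last exact: (bounded_mfun_integrable P _ (bounded_mfun_cst 1)).
  rewrite integral_cst// mul1e -[X in (X + _)%E]/(P setT) probability_setT EFinD.
  by congr (_ + _)%E; rewrite /Rintegral fineK//; exact: integrable_fin_num.
suff : (\int[P]_w (1 + cos (X w))%:E = (1 + normal_charfun s2)%:E)%E.
  by rewrite E1 => -[]; lra.
rewrite /normal_charfun; have [s0|s0] := eqVneq s2 0.
  rewrite (ge0_integral_law P (\d_(0 : R)) X mX (fun y : R => (1 + cos y)%:E))//.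
    by rewrite integral_dirac// diracT mul1e cos0.
  by move=> B mB; have := lawX B mB; rewrite /centered_normal_law s0 eqxx.
have ss0 : Num.sqrt s2 != 0 by rewrite gt_eqF// sqrtr_gt0 lt_neqAle eq_sym s0.
rewrite (@ge0_integral_law _ _ _ (measurableTypeR R) _ P
  (normal_prob 0 (Num.sqrt s2)) X mX (fun y : R => (1 + cos y)%:E))//; last first.
  by move=> B mB; have := lawX B mB; rewrite /centered_normal_law (negbTE s0).
rewrite (@ge0_integral_density _ _ _ lebesgue_measure _ (normal_pdf 0 (Num.sqrt s2)))//.
- under eq_integral do rewrite -EFinM mulrDl mul1r EFinD.
  have i := integrable_cos_normal _ ss0.
  rewrite integralD//; last exact: integrable_normal_pdf.
  rewrite integral_normal_pdf EFinD; congr (_ + _)%E.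
  by rewrite /Rintegral fineK//; exact: integrable_fin_num.
- exact: measurable_normal_pdf.
- by move=> x; exact: normal_pdf_ge0.
Qed.

Lemma normal_law_tail (x : R) : 0 <= s2 ->
  (P [set w | x <= X w]%R <= (expR (- x + s2 / 2))%:E)%E.
Proof.
move=> s20.
have -> : [set w | x <= X w]%R = X @^-1` `[x, +oo[%classic.
  by apply/seteqP; split => w /=; rewrite in_itv/= andbT.
rewrite lawX// /centered_normal_law; case: ifPn => s0.
  rewrite /dirac indicE (eqP s0) mul0r addr0 lee_fin.
  have [|_] := boolP (_ \in _); last exact: expR_ge0.
  rewrite inE/= in_itv/= andbT => x0.
  by rewrite -expR0 ler_expR oppr_ge0.
have ss0 : Num.sqrt s2 != 0 by rewrite gt_eqF// sqrtr_gt0 lt_neqAle eq_sym s0.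
by have := normal_prob_mgf _ x ss0; rewrite sqr_sqrtr.
Qed.

(* For [s2 < 0] the law would be uniform on [0, 1], which is not symmetric. *)
Lemma normal_law_var_ge0 :
  (forall B, measurable B -> P ((fun w => - X w) @^-1` B) = centered_normal_law s2 B) ->
  0 <= s2.
Proof.
move=> lawNX; rewrite leNgt; apply/negP => s20.
have u B : measurable B -> centered_normal_law s2 B = lebesgue_measure (B `&` `[0, 1]%classic).
  move=> mB; rewrite /centered_normal_law lt_eqF// /normal_prob /normal_pdf.
  by rewrite ler0_sqrtr ?ltW// eqxx integral_indic// setIC.
have h1 : P (X @^-1` `]-oo, 0]%classic) = 0%E.
  rewrite lawX// u//.
  rewrite (_ : _ `&` _ = [set 0]) ?lebesgue_measure_set1//.
  apply/seteqP; split => x /=; rewrite !in_itv/=.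
    by move=> [x0 /andP[x0' _]]; apply/eqP; rewrite eq_le x0 x0'.
  by move=> ->; rewrite lexx ler01.
have h2 : P (X @^-1` `]-oo, 0]%classic) = 1%E.
  have -> : X @^-1` `]-oo, 0]%classic = (fun w => - X w) @^-1` `[0, +oo[%classic.
    by apply/seteqP; split => w /=; rewrite !in_itv/= andbT oppr_ge0.
  rewrite lawNX// u// (_ : _ `&` _ = `[0, 1]%classic).
    by rewrite lebesgue_measure_itv/= lte01 oppr0 adde0.
  apply/seteqP; split => x /=; rewrite !in_itv/=; first by case.
  by move=> /andP[-> ->].
by move: h2; rewrite h1 => /eqP; rewrite eq_sym onee_eq0.
Qed.

End normal_law.

(** * A Cramer-Wold device *)

Section step_approx.
Context {R : realType}.

Lemma cvg_nat_mul_exp (x : R) : 0 <= x < 1 -> m%:R * x ^+ m @[m --> \oo] --> (0 : R).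
Proof.
move=> /andP[x0 x1].
have [->|xn0] := eqVneq x 0.
  apply: cvg_near_cst; near=> m; rewrite expr0n.
  have -> : (m == 0)%N = false by apply/negbTE; rewrite -lt0n; near: m; exact: nbhs_infty_gt.
  by rewrite mulr0.
have {x0 xn0} x0 : 0 < x by rewrite lt_neqAle eq_sym xn0.
pose t := - ln x.
have t0 : 0 < t by rewrite oppr_gt0 ln_lt0// x0 x1.
have key m : 0 <= m%:R * x ^+ m <= 2 / t ^+ 2 * (m%:R)^-1.
  rewrite mulr_ge0 ?exprn_ge0 ?(ltW x0)//=.
  case: m => [|m]; first by rewrite mul0r invr0 mulr0.
  have m0 : 0 < m.+1%:R :> R by rewrite ltr0n.
  have := @expR_ge1Dxn R (m.+1%:R * t) 1 (mulr_ge0 (ltW m0) (ltW t0)).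
  rewrite expRM_natl expRN lnK ?posrE// exprVn => h.
  have xm0 : 0 < x ^+ m.+1 by rewrite exprn_gt0.
  have h2 : (m.+1%:R * t) ^+ 2 / 2 <= (x ^+ m.+1)^-1.
    by apply: le_trans h; rewrite -[leLHS]add0r lerD.
  have : (m.+1%:R * t) ^+ 2 / 2 * x ^+ m.+1 <= 1.
    by rewrite -[leRHS](mulVf (lt0r_neq0 xm0)) ler_wpM2r// (ltW xm0).
  move=> h3; rewrite ler_pdivlMr// ler_pdivlMr ?exprn_gt0//.
  have -> : m.+1%:R * x ^+ m.+1 * m.+1%:R * t ^+ 2 = 2 * ((m.+1%:R * t) ^+ 2 / 2 * x ^+ m.+1).
    by field.
  by rewrite -[leRHS]mulr1 ler_pM2l.
apply: (@squeeze_cvgr _ _ _ _ (cst 0) (fun m : nat => 2 / t ^+ 2 * (m%:R)^-1)).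
- by apply: nearW => m; exact: key.
- exact: cvg_cst.
- rewrite -[X in _ --> X](mulr0 (2 / t ^+ 2)); apply: cvgM; first exact: cvg_cst.
  apply/gtr0_cvgV0; last exact: cvgr_idn.
  by near=> m; rewrite ltr0n; near: m; exact: nbhs_infty_gt.
Unshelve. all: by end_near. Qed.

Lemma bernoulli_ineq (u : R) n : 0 <= u <= 1 -> 1 - n%:R * u <= (1 - u) ^+ n.
Proof.
move=> /andP[u0 u1]; elim: n => [|n IH]; first by rewrite mul0r subr0 expr0.
rewrite exprS; apply: (@le_trans _ _ ((1 - u) * (1 - n%:R * u))).
  rewrite -natr1; have : 0 <= (n%:R : R) by []. nra.
by rewrite ler_wpM2l// subr_ge0.
Qed.

(* The exponent, of order [m c^-m], is large against [y^-m] exactly when [c <= y]. *)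
Definition step_poly (c : R) (m : nat) (y : R) : R :=
  1 - (1 - y ^+ m) ^+ (m * (Num.truncn (c ^- m)).+1).

Lemma step_poly_bound c m y : 0 <= y <= 1 -> 0 <= step_poly c m y <= 1.
Proof.
move=> /andP[y0 y1]; have ym : 0 <= 1 - y ^+ m <= 1.
  by rewrite subr_ge0 exprn_ile1//= gerBl exprn_ge0.
rewrite /step_poly subr_ge0 gerBl; case/andP: ym => a b.
by rewrite exprn_ile1// exprn_ge0.
Qed.

(** With [N] the exponent: for [c <= y], [(1 - y^m)^N <= exp(- N y^m) <= exp(- m)], the factor [m]
    in [N] securing the endpoint [y = c]; for [y < c], Bernoulli's inequality bounds the value by
    [N y^m <= 2 m (y / c)^m]. *)
Lemma step_poly_cvg c y : 0 < c <= 1 -> 0 <= y <= 1 ->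
  step_poly c m y @[m --> \oo] --> ((c <= y)%R%:R : R).
Proof.
move=> /andP[c0 c1] /andP[y0 y1].
have N1 m : c ^- m < (Num.truncn (c ^- m)).+1%:R by exact: truncnS_gt.
have N2 m : (Num.truncn (c ^- m))%:R <= c ^- m.
  by rewrite truncn_le// invr_ge0 exprn_ge0// ltW.
have ym m : 0 <= y ^+ m <= 1 by rewrite exprn_ge0// exprn_ile1.
have cm m : 0 < c ^+ m by rewrite exprn_gt0.
have [cy|yc] := leP c y.
  apply: (@squeeze_cvgr _ _ _ _ (fun m : nat => 1 - (m.+1%:R)^-1) (cst 1)).
  - apply: nearW => m; have /andP[_ ->] := step_poly_bound c m y (introT andP (conj y0 y1)).
    rewrite andbT lerD2l lerN2.
    apply: (@le_trans _ _ (expR (- m%:R))).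
      apply: (@le_trans _ _ (expR (- y ^+ m) ^+ (m * (Num.truncn (c ^- m)).+1))).
        by apply: lerXn2r; rewrite ?nnegrE ?subr_ge0 ?expR_ge0//; [case/andP: (ym m)|exact: expR_ge1Dx].
      rewrite -expRM_natl ler_expR mulrN lerN2 natrM -mulrA ler_peMr//.
      apply: (@le_trans _ _ (c ^- m * y ^+ m)); last first.
        by apply: ler_wpM2r; [case/andP: (ym m)|exact: ltW].
      by rewrite ler_pdivlMl// mulr1 lerXn2r// nnegrE// ltW.
    by rewrite expRN lef_pV2 ?posrE ?expR_gt0// -nat1r expR_ge1Dx.
  - rewrite -[X in _ --> X]subr0; apply: cvgB; first exact: cvg_cst.
    exact: cvg_harmonic.
  - exact: cvg_cst.
apply: (@squeeze_cvgr _ _ _ _ (cst 0) (fun m : nat => 2 * (m%:R * (y / c) ^+ m))).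
- apply: nearW => m; have /andP[-> _] /= := step_poly_bound c m y (introT andP (conj y0 y1)).
  have := bernoulli_ineq (y ^+ m) (m * (Num.truncn (c ^- m)).+1) (ym m).
  rewrite /step_poly => h.
  apply: (@le_trans _ _ ((m * (Num.truncn (c ^- m)).+1)%:R * y ^+ m)); first lra.
  rewrite exprMn natrM exprVn mulrCA -!mulrA ler_wpM2l// (mulrC (y ^+ m)) mulrA ler_wpM2r//.
    by case/andP: (ym m).
  rewrite -nat1r; have := N2 m.
  have : 1 <= c ^- m by rewrite invf_ge1// exprn_ile1// ltW.
  lra.
- exact: cvg_cst.
- rewrite -[X in _ --> X](mulr0 2); apply: cvgM; first exact: cvg_cst.
  by apply: cvg_nat_mul_exp; rewrite divr_ge0 ?(ltW c0)//= ltr_pdivrMr// mul1r.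
Qed.

(** For [s >= 0] the summand [truncn s + 1] keeps [s] times the scale in [[0, 1]], where the cosine
    decreases, for every [k]; the decay in [k] removes periodicity in the limit. *)
Definition cos_scale (s : R) (k : nat) : R := ((k + (Num.truncn s).+1)%:R)^-1.

Definition cos_step (s : R) (k : nat) (x : R) : R := (1 + cos (cos_scale s k * x)) / 2.

Lemma cos_step_itv s k x : 0 <= cos_step s k x <= 1.
Proof. by rewrite /cos_step; have := cos_geN1 (cos_scale s k * x); have := cos_le1 (cos_scale s k * x); lra. Qed.

Let cos_scale_pi (s : R) k (x : R) : 0 <= x -> x <= (k + (Num.truncn s).+1)%:R ->
  0 <= cos_scale s k * x <= 1.
Proof.
move=> x0 xk; by rewrite /cos_scale mulr_ge0//= mulrC ler_pdivrMr ?mul1r// ltr0n addnS.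
Qed.

Let mem_pi (x : R) : 0 <= x <= 1 -> x \in `[0, pi].
Proof. by move=> x01; rewrite in_itv/=; have := pi_ge2 R; lra. Qed.

Let le_natD (s : R) k : 0 <= s -> s <= (k + (Num.truncn s).+1)%:R.
Proof.
move=> s0; rewrite (le_trans (ltW (truncnS_gt s)))// ler_nat; exact: leq_addl.
Qed.

Lemma cos_step_gt0 s k : 0 <= s -> 0 < cos_step s k s.
Proof.
move=> s0; rewrite divr_gt0// -(subrr 1) ltrD2l -cospi ltr_cos.
- by have := cos_scale_pi s k s s0 (le_natD s k s0); have := pi_ge2 R; lra.
- exact/mem_pi/cos_scale_pi/le_natD.
- by rewrite in_itv/= lexx pi_ge0.
Qed.

(** Once [k >= |x|], both scaled arguments lie in [[0, 1]], where comparing cosines is comparing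
    absolute values: the sequence is eventually constant. *)
Lemma cos_step_cvg (s x : R) : 0 <= s ->
  ((cos_step s k s <= cos_step s k x)%R%:R : R) @[k --> \oo] --> ((`|x| <= s)%R%:R : R).
Proof.
move=> s0; apply: cvg_near_cst; near=> k.
have xk : `|x| <= (k + (Num.truncn s).+1)%:R.
  rewrite natrD (le_trans (_ : _ <= k%:R)) ?lerDl//.
  by near: k; exact: nbhs_infty_ger.
congr (_%:R); rewrite ler_pM2r ?invr_gt0// lerD2l -[cos (_ * x)]cos_norm normrM.
have sc0 : 0 < cos_scale s k by rewrite invr_gt0 ltr0n addnS.
rewrite (gtr0_norm sc0) !leNgt ltr_cos; last 2 first.
- exact/mem_pi/cos_scale_pi/le_natD.
- exact/mem_pi/cos_scale_pi.
by rewrite ltr_pM2l.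
Unshelve. all: by end_near. Qed.

End step_approx.

Section cramer_wold.
Context {d} {T : measurableType d} {R : realType} (P : probability T R) (I : Type).

Definition lincomb (X : I -> T -> R) (cs : seq (R * I)) (w : T) : R :=
  \sum_(p <- cs) p.1 * X p.2 w.

Lemma measurable_lincomb X cs : (forall i, measurable_fun setT (X i)) ->
  measurable_fun setT (lincomb X cs).
Proof. by move=> mX; apply: measurable_sum => p; exact: measurable_funM. Qed.

Variables U V : I -> T -> R.
Hypotheses (mU : forall i, measurable_fun setT (U i))
  (mV : forall i, measurable_fun setT (V i)).

(** The image of [G P] under [U] and that of [H P] under [V] have the same cosine transform.
    Quantifying over all combinations makes this stable under multiplication by cosines of
    coordinates; allowing [G] and [H] to differ lets one of them be a constant, which is how
    independence is expressed. *)
Definition agree (G H : T -> R) := [/\ bounded_mfun G, bounded_mfun H &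
  forall cs, \int[P]_w (cos (lincomb U cs w) * G w) =
             \int[P]_w (cos (lincomb V cs w) * H w)].

Let icos X (mX : forall i, measurable_fun setT (X i)) cs G : bounded_mfun G ->
  P.-integrable setT (EFin \o (fun w => cos (lincomb X cs w) * G w)).
Proof.
move=> bG; apply: bounded_mfun_integrable; apply: bounded_mfunM => //.
by apply: bounded_mfun_cos; exact: measurable_lincomb.
Qed.

Lemma agreeB G H G' H' : agree G H -> agree G' H' ->
  agree (fun w => G w - G' w) (fun w => H w - H' w).
Proof.
move=> [bG bH GH] [bG' bH' GH']; split; [exact: bounded_mfunB..|move=> cs].
under eq_Rintegral do rewrite mulrBr.
under [RHS]eq_Rintegral do rewrite mulrBr.
rewrite !RintegralB ?GH ?GH'//; exact: icos.
Qed.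

Lemma agreeZ c G H : agree G H -> agree (fun w => c * G w) (fun w => c * H w).
Proof.
move=> [bG bH GH]; split; [by apply: bounded_mfunM => //; exact: bounded_mfun_cst..|move=> cs].
under eq_Rintegral do rewrite mulrCA.
under [RHS]eq_Rintegral do rewrite mulrCA.
rewrite !RintegralZl ?GH//; exact: icos.
Qed.

(** By the product formula a further cosine factor only changes the combination, by prepending [a]
    or [- a] times the coordinate [i]. *)
Lemma agree_cos a i G H : agree G H ->
  agree (fun w => cos (a * U i w) * G w) (fun w => cos (a * V i w) * H w).
Proof.
move=> [bG bH GH]; split.
- by apply: bounded_mfunM => //; apply: bounded_mfun_cos; exact: measurable_funM.
- by apply: bounded_mfunM => //; apply: bounded_mfun_cos; exact: measurable_funM.
move=> cs.
have E X w (F : T -> R) : cos (lincomb X cs w) * (cos (a * X i w) * F w) =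
    2^-1 * (cos (lincomb X ((a, i) :: cs) w) * F w + cos (lincomb X ((- a, i) :: cs) w) * F w).
  by rewrite /lincomb !big_cons /= mulNr !cosD cosN sinN; field.
under eq_Rintegral do rewrite E.
under [RHS]eq_Rintegral do rewrite E.
rewrite !RintegralZl// ?RintegralD//; try exact: icos.
- by rewrite !GH.
- by apply: bounded_mfun_integrable; apply: bounded_mfunD; apply: bounded_mfunM => //;
    apply: bounded_mfun_cos; exact: measurable_lincomb.
- by apply: bounded_mfun_integrable; apply: bounded_mfunD; apply: bounded_mfunM => //;
    apply: bounded_mfun_cos; exact: measurable_lincomb.
Qed.

(** Functions of one coordinate that may be inserted in the weights. They form an algebra containing
    the cosines and closed under bounded pointwise limits; the family [agree] is then enlarged
    coordinate by coordinate. *)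
Definition multiplier (i : I) (F : R -> R) :=
  [/\ measurable_fun setT F, exists C : R, forall x, `|F x| <= C &
   forall G H, agree G H -> agree (fun w => F (U i w) * G w) (fun w => F (V i w) * H w)].

Lemma multiplier_cos i a : multiplier i (fun x => cos (a * x)).
Proof.
split => [||G H]; last exact: agree_cos.
- have : measurable_fun setT (fun x : R => a * x) by exact: measurable_funM.
  by move=> /bounded_mfun_cos [].
- by exists 1 => x; rewrite ler_norml cos_geN1 cos_le1.
Qed.

Lemma multiplier_cst i c : multiplier i (fun=> c).
Proof.
split => [||G H]; [exact: measurable_cst| |exact: agreeZ].
by exists `|c|.
Qed.

Lemma multiplierB i F F' : multiplier i F -> multiplier i F' ->
  multiplier i (fun x => F x - F' x).
Proof.
move=> [mF [C FC] hF] [mF' [C' FC'] hF']; split; first exact: measurable_funB.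
  by exists (C + C') => x; rewrite (le_trans (ler_normB _ _))// lerD.
move=> G H GH; have := agreeB _ _ _ _ (hF _ _ GH) (hF' _ _ GH).
by under eq_fun do rewrite -mulrBl; under [X in agree _ X]eq_fun do rewrite -mulrBl.
Qed.

Lemma multiplierM i F F' : multiplier i F -> multiplier i F' ->
  multiplier i (fun x => F x * F' x).
Proof.
move=> [mF [C FC] hF] [mF' [C' FC'] hF']; split; first exact: measurable_funM.
  by exists (C * C') => x; rewrite normrM ler_pM.
move=> G H GH; have := hF _ _ (hF' _ _ GH).
by under eq_fun do rewrite mulrA; under [X in agree _ X]eq_fun do rewrite mulrA.
Qed.

Lemma multiplierX i F n : multiplier i F -> multiplier i (fun x => F x ^+ n).
Proof.
move=> hF; elim: n => [|n IH]; first exact: (multiplier_cst i 1).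
by under eq_fun do rewrite exprS; exact: multiplierM.
Qed.

Lemma multiplier_cvg i (F_ : nat -> R -> R) (F : R -> R) (C : R) : (forall n, multiplier i (F_ n)) ->
  (forall n x, `|F_ n x| <= C) -> (forall x, F_ n x @[n --> \oo] --> F x) ->
  multiplier i F.
Proof.
move=> hF FC cF.
have mF : measurable_fun setT F.
  by apply: (measurable_fun_cvg (h := F_)) => [n|x _]; [case: (hF n)|exact: cF].
have FC' x : `|F x| <= C.
  have : `|F_ n x| @[n --> \oo] --> `|F x| by apply: cvg_norm; exact: cF.
  move=> /cvgr_to_le; apply; exact: nearW.
split => //; first by exists C.
move=> G H GH; have [bG bH _] := GH.
have bX X : measurable_fun setT X -> bounded_mfun (fun w : T => F (X w)).
  by move=> mX; split; [exact: measurableT_comp|exists C => w].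
split; [exact/bounded_mfunM/bG/bX|exact/bounded_mfunM/bH/bX|move=> cs].
have lim X (mX : forall i, measurable_fun setT (X i)) K : bounded_mfun K ->
    \int[P]_w (cos (lincomb X cs w) * (F_ n (X i w) * K w)) @[n --> \oo] -->
    \int[P]_w (cos (lincomb X cs w) * (F (X i w) * K w)).
  move=> [mK [D KD]].
  have [mc _] := bounded_mfun_cos _ (measurable_lincomb X cs mX).
  apply: (@Rintegral_bounded_cvg _ _ _ _ _ _ (1 * (C * D))).
  - move=> n; apply: measurable_funM => //; apply: measurable_funM => //.
    by apply: measurableT_comp => //; case: (hF n).
  - by apply: measurable_funM => //; apply: measurable_funM => //; exact: measurableT_comp.
  - move=> n w; rewrite !normrM ler_pM//; first by rewrite ler_norml cos_geN1 cos_le1.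
    by rewrite ler_pM.
  - move=> w; apply: cvgM; first exact: cvg_cst.
    by apply: cvgM; [exact: cF|exact: cvg_cst].
have l1 := lim _ mU _ bG; have l2 := lim _ mV _ bH.
rewrite -(cvg_lim (@Rhausdorff R) l1) -(cvg_lim (@Rhausdorff R) l2).
have -> // : (fun n => \int[P]_w (cos (lincomb U cs w) * (F_ n (U i w) * G w))) =
  (fun n => \int[P]_w (cos (lincomb V cs w) * (F_ n (V i w) * H w))).
by apply/funext => n; have [_ _ /(_ _ _ GH)[_ _ ->]] := hF n.
Qed.

(** Two successive limits: in [m], polynomials in a cosine become the indicator of a periodic set;
    in [k], the period grows and only the interval around 0 remains. *)
Lemma multiplier_itv i (s : R) : 0 <= s -> multiplier i (fun x => (`|x| <= s)%R%:R).
Proof.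
move=> s0.
apply: (@multiplier_cvg _ (fun k x => (cos_step s k s <= cos_step s k x)%R%:R) _ 1).
- move=> k.
  apply: (@multiplier_cvg _ (fun m x => step_poly (cos_step s k s) m (cos_step s k x)) _ 1).
  + move=> m; apply: multiplierB; first exact: multiplier_cst.
    apply: multiplierX; apply: multiplierB; first exact: multiplier_cst.
    apply: multiplierX; rewrite /cos_step.
    have -> : (fun x => (1 + cos (cos_scale s k * x)) / 2) =
        (fun x => 2^-1 - (- 2^-1) * cos (cos_scale s k * x)).
      by apply/funext => x; field.
    apply: multiplierB; first exact: multiplier_cst.
    by apply: multiplierM; [exact: multiplier_cst|exact: multiplier_cos].
  + move=> m x; have := step_poly_bound (cos_step s k s) m _ (cos_step_itv s k x).
    by rewrite ler_norml; lra.
  + move=> x; apply: step_poly_cvg; last exact: cos_step_itv.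
    by rewrite cos_step_gt0//; case/andP: (cos_step_itv s k s).
- by move=> k x; rewrite normr_nat lern1 leq_b1.
- by move=> x; exact: cos_step_cvg.
Qed.

Definition in_box (X : I -> T -> R) (s : seq (I * R)) (w : T) : bool :=
  all (fun p => `|X p.1 w| <= p.2) s.

Theorem agree_box G H s : agree G H -> all (fun p => 0 <= p.2) s ->
  \int[P]_w ((in_box U s w)%:R * G w) = \int[P]_w ((in_box V s w)%:R * H w).
Proof.
move=> GH s0.
suff [_ _ /(_ [::])] : agree (fun w => (in_box U s w)%:R * G w) (fun w => (in_box V s w)%:R * H w).
  rewrite /lincomb; under eq_Rintegral do rewrite big_nil cos0 mul1r.
  by under [RHS]eq_Rintegral do rewrite big_nil cos0 mul1r.
elim: s s0 => [_|[i s] l IH /= /andP[s0 l0]].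
  by rewrite /in_box /=; under eq_fun do rewrite mul1r; under [X in agree _ X]eq_fun do rewrite mul1r.
have [_ _ /(_ _ _ (IH l0))] := multiplier_itv i s s0.
by rewrite /in_box /=; under eq_fun do rewrite mulrA -natrM mulnb;
  under [X in agree _ X]eq_fun do rewrite mulrA -natrM mulnb.
Qed.

End cramer_wold.

(** * Gaussian families and Fernique's inequality *)

Section probability_reals.
Context {d} {T : measurableType d} {R : realType} (P : probability T R).

Definition pr (A : set T) : R := fine (P A).

Lemma prE A : measurable A -> P A = (pr A)%:E.
Proof. by move=> mA; rewrite /pr fineK// fin_num_measure. Qed.

Lemma pr_ge0 A : 0 <= pr A.
Proof. by rewrite fine_ge0. Qed.

Lemma pr_set0 : pr set0 = 0.
Proof. by rewrite /pr measure0. Qed.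

Lemma le_pr A B : measurable A -> measurable B -> A `<=` B -> pr A <= pr B.
Proof. by move=> mA mB AB; rewrite -lee_fin -!prE// le_measure// inE. Qed.

Lemma pr_setC A : measurable A -> pr (~` A) = 1 - pr A.
Proof.
move=> mA; apply: EFin_inj; rewrite EFinB -!prE//; last exact: measurableC.
exact: probability_setC.
Qed.

Lemma pr_le1 A : measurable A -> pr A <= 1.
Proof. by move=> mA; rewrite -lee_fin -prE// probability_le1. Qed.

Lemma pr_setD A B : measurable A -> measurable B -> pr (A `\` B) = pr A - pr (A `&` B).
Proof.
move=> mA mB; apply: EFin_inj; rewrite EFinB -!prE//; last 2 first.
- exact: measurableI.
- exact: measurableD.
by rewrite measureD// -[ltLHS]/(P A) (le_lt_trans (probability_le1 P mA))// ltry.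
Qed.

Lemma pr_setU A B : measurable A -> measurable B -> pr (A `|` B) <= pr A + pr B.
Proof.
move=> mA mB; rewrite -lee_fin EFinD -!prE//; last exact: measurableU.
exact: measureU2.
Qed.

Lemma natr_bool_indic (p : pred T) : (fun w => (p w)%:R) = \1_[set w | p w] :> (T -> R).
Proof.
apply/funext => w; rewrite indicE; congr ((nat_of_bool _)%:R).
by apply/idP/idP => [pw|/set_mem//]; exact/mem_set.
Qed.

Lemma Rintegral_bool (p : pred T) : measurable [set w | p w] ->
  \int[P]_w (p w)%:R = pr [set w | p w].
Proof. by move=> mp; rewrite natr_bool_indic Rintegral_indic. Qed.

End probability_reals.

Section gaussian_family.
Context {d} {T : measurableType d} {R : realType} (P : probability T R) (I : Type).
Variables (X : I -> T -> R) (K : I -> I -> R).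
Hypothesis gX : centered_gaussian_family P X K.
Hypothesis Ksym : forall i j, K i j = K j i.
Implicit Types L M : seq (R * I).
Local Notation lin := (lincomb I X).
Local Notation pr := (pr P).

Definition cov L M : R := \sum_(p <- L) \sum_(q <- M) p.1 * q.1 * K p.2 q.2.

Definition scal (c : R) L := [seq (c * p.1, p.2) | p <- L].

Lemma lin_cat L M w : lin (L ++ M) w = lin L w + lin M w.
Proof. by rewrite /lincomb big_cat. Qed.

Lemma lin_scal c L w : lin (scal c L) w = c * lin L w.
Proof.
rewrite /lincomb big_map mulr_sumr; apply: eq_bigr => p _; by rewrite mulrA.
Qed.

Lemma cov_catl L L' M : cov (L ++ L') M = cov L M + cov L' M.
Proof. by rewrite /cov big_cat. Qed.

Lemma cov_catr L L' M : cov M (L ++ L') = cov M L + cov M L'.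
Proof. by rewrite /cov -big_split/=; apply: eq_bigr => p _; rewrite big_cat. Qed.

Lemma cov_scall c L M : cov (scal c L) M = c * cov L M.
Proof.
rewrite /cov big_map mulr_sumr; apply: eq_bigr => p _.
by rewrite mulr_sumr; apply: eq_bigr => q _ /=; rewrite !mulrA.
Qed.

Lemma cov_sym L M : cov L M = cov M L.
Proof.
rewrite /cov exchange_big/=; apply: eq_bigr => p _; apply: eq_bigr => q _.
by rewrite Ksym (mulrC q.1).
Qed.

Lemma cov_scalr c L M : cov M (scal c L) = c * cov M L.
Proof. by rewrite cov_sym cov_scall cov_sym. Qed.

Definition covE := (cov_catl, cov_catr, cov_scall, cov_scalr).

Lemma measurable_lin L : measurable_fun setT (lin L).
Proof. by apply: measurable_lincomb; case: gX. Qed.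

Let lin_law L B : measurable B -> P (lin L @^-1` B) = centered_normal_law (cov L L) B.
Proof. by case: gX => _; exact. Qed.

(** Positivity is read off the laws: [L] and its opposite have the same variance parameter, and a
    negative parameter would yield a law that is not symmetric. *)
Lemma cov_ge0 L : 0 <= cov L L.
Proof.
apply: (normal_law_var_ge0 P (lin L)); first exact: lin_law.
have -> : (fun w => - lin L w) = lin (scal (-1) L).
  by apply/funext => w; rewrite lin_scal mulN1r.
have -> : cov L L = cov (scal (-1) L) (scal (-1) L).
  by rewrite !covE mulrA mulrNN !mul1r.
exact: lin_law.
Qed.

Lemma lin_tail L x : pr [set w | x <= lin L w] <= expR (- x + cov L L / 2).
Proof.
have mA : measurable [set w | x <= lin L w].
  rewrite -[X in measurable X]setTI.
  have -> : [set w | x <= lin L w] = lin L @^-1` `[x, +oo[%classic.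
    by apply/seteqP; split => w /=; rewrite in_itv/= andbT.
  exact: measurable_lin.
rewrite -lee_fin -prE//; apply: normal_law_tail; last exact: cov_ge0.
by move=> B; exact: lin_law.
Qed.

Lemma lin_cos L : \int[P]_w cos (lin L w) = normal_charfun (cov L L).
Proof.
by apply: normal_law_cos; [exact: measurable_lin|exact: lin_law|exact: cov_ge0].
Qed.

Section families.
Variable J : Type.
Implicit Types F G : J -> seq (R * I).

(** Rewrites a combination of the derived variables [lin (F j)] as one of the [X i], so that the
    hypothesis on laws reaches families of derived variables. *)
Definition flat F (cs : seq (R * J)) := flatten [seq scal p.1 (F p.2) | p <- cs].

Lemma lin_flat F cs w : lin (flat F cs) w = lincomb J (fun j => lin (F j)) cs w.
Proof.
elim: cs => [|p cs IH]; first by rewrite /lincomb !big_nil.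
by rewrite /flat /= lin_cat IH lin_scal /lincomb big_cons.
Qed.

Lemma cov_flatl F cs M : cov (flat F cs) M = \sum_(p <- cs) p.1 * cov (F p.2) M.
Proof.
elim: cs => [|p cs IH]; first by rewrite /cov !big_nil.
by rewrite /flat /= cov_catl IH cov_scall big_cons.
Qed.

Lemma cov_flat_eq F G cs : (forall j k, cov (F j) (F k) = cov (G j) (G k)) ->
  cov (flat F cs) (flat F cs) = cov (flat G cs) (flat G cs).
Proof.
move=> FG; rewrite !cov_flatl; apply: eq_bigr => p _.
rewrite cov_sym [in RHS]cov_sym !cov_flatl; congr (_ * _).
by apply: eq_bigr => q _; rewrite FG.
Qed.

Lemma measurable_box F s : measurable [set w | in_box J (fun j => lin (F j)) s w].
Proof.
elim: s => [|p s IH]; first by rewrite [X in measurable X](_ : _ = setT)//; apply/seteqP; split.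
have -> : [set w | in_box J (fun j => lin (F j)) (p :: s) w] =
  (lin (F p.1) @^-1` `[- p.2, p.2]%classic) `&` [set w | in_box J (fun j => lin (F j)) s w].
  apply/seteqP; split => w /=; rewrite /in_box /= in_itv/= -ler_norml; first by move=> /andP.
  by move=> [-> ->].
by apply: measurableI => //; rewrite -[X in measurable X]setTI; exact: measurable_lin.
Qed.

Lemma gauss_box_eq F G s : (forall j k, cov (F j) (F k) = cov (G j) (G k)) ->
  all (fun p => 0 <= p.2) s ->
  pr [set w | in_box J (fun j => lin (F j)) s w] =
  pr [set w | in_box J (fun j => lin (G j)) s w].
Proof.
move=> FG s0.
have ag : agree P J (fun j => lin (F j)) (fun j => lin (G j)) (fun=> 1) (fun=> 1).
  split; [exact: bounded_mfun_cst..|move=> cs].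
  under eq_Rintegral do rewrite mulr1 -lin_flat.
  under [RHS]eq_Rintegral do rewrite mulr1 -lin_flat.
  by rewrite !lin_cos (cov_flat_eq F G).
have := agree_box P J _ _ (fun j => measurable_lin (F j)) (fun j => measurable_lin (G j)) _ _ s ag s0.
under eq_Rintegral do rewrite mulr1.
under [X in _ = X -> _]eq_Rintegral do rewrite mulr1.
by rewrite !Rintegral_bool//; exact: measurable_box.
Qed.

End families.

(** Cosines factorize first: when [cov L M = 0], [L + M] and [L - M] have the same variance, which
    [normal_charfunD] splits. Boxes are then brought in one group at a time by [agree_box]. *)
Lemma gauss_box_indep (J J' : Type) (F : J -> seq (R * I)) (G : J' -> seq (R * I)) s s' :
  (forall j k, cov (F j) (G k) = 0) ->
  all (fun p => 0 <= p.2) s -> all (fun p => 0 <= p.2) s' ->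
  pr ([set w | in_box J (fun j => lin (F j)) s w] `&`
      [set w | in_box J' (fun j => lin (G j)) s' w]) =
  pr [set w | in_box J (fun j => lin (F j)) s w] *
  pr [set w | in_box J' (fun j => lin (G j)) s' w].
Proof.
move=> FG s0 s0'.
set U := fun j => lin (F j); set V := fun j => lin (G j).
have mU j : measurable_fun setT (U j) by exact: measurable_lin.
have mV j : measurable_fun setT (V j) by exact: measurable_lin.
have cosM L M : cov L M = 0 -> \int[P]_w (cos (lin L w) * cos (lin M w)) =
    \int[P]_w cos (lin L w) * \int[P]_w cos (lin M w).
  move=> LM.
  have E w : cos (lin L w) * cos (lin M w) =
      2^-1 * (cos (lin (L ++ M) w) + cos (lin (L ++ scal (-1) M) w)).
    by rewrite !lin_cat lin_scal mulN1r !cosD cosN sinN; field.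
  under eq_Rintegral do rewrite E.
  have i N : P.-integrable setT (EFin \o (fun w => cos (lin N w))).
    by apply: bounded_mfun_integrable; apply: bounded_mfun_cos; exact: measurable_lin.
  rewrite RintegralZl//; last first.
    by apply: bounded_mfun_integrable; apply: bounded_mfunD; apply: bounded_mfun_cos; exact: measurable_lin.
  rewrite RintegralD// !lin_cos !covE (cov_sym M L) LM !mulr0 !addr0 !add0r !mulN1r opprK.
  rewrite normal_charfunD ?cov_ge0//.
  by move: (normal_charfun _) (normal_charfun _) => x y; field.
have cV ds : bounded_mfun (fun w => cos (lincomb J' V ds w)).
  by apply: bounded_mfun_cos; exact: measurable_lincomb.
have cU cs : bounded_mfun (fun w => cos (lincomb J U cs w)).
  by apply: bounded_mfun_cos; exact: measurable_lincomb.
have mbU := measurable_box J F s; have mbV := measurable_box J' G s'.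
have bU : bounded_mfun (fun w => (in_box J U s w)%:R : R).
  by rewrite natr_bool_indic; exact: bounded_mfun_indic.
(* Both families are [U] here; the cosine of the second group is compared with the constant equal to
   its mean. *)
have A1 ds : \int[P]_w ((in_box J U s w)%:R * cos (lincomb J' V ds w)) =
    pr [set w | in_box J U s w] * \int[P]_w cos (lincomb J' V ds w).
  set c := \int[P]_w cos (lincomb J' V ds w).
  have ag : agree P J U U (fun w => cos (lincomb J' V ds w)) (fun=> c).
    split => //; first exact: bounded_mfun_cst.
    move=> cs; rewrite RintegralZr//; last exact: bounded_mfun_integrable.
    rewrite /c; have -> : lincomb J U cs = lin (flat J F cs) by apply/funext => w; rewrite lin_flat.
    have -> : lincomb J' V ds = lin (flat J' G ds) by apply/funext => w; rewrite lin_flat.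
    rewrite -cosM//.
    rewrite cov_flatl big1// => p _; rewrite cov_sym cov_flatl big1 ?mulr0// => q _.
    by rewrite cov_sym FG mulr0.
  rewrite (agree_box P J _ _ mU mU _ _ s ag s0) RintegralZr ?Rintegral_bool//.
  exact: bounded_mfun_integrable.
(* The roles are exchanged: the box of the first group has become the weight. *)
have ag : agree P J' V V (fun w => (in_box J U s w)%:R) (fun=> pr [set w | in_box J U s w]).
  split => //; first exact: bounded_mfun_cst.
  move=> ds; rewrite RintegralZr//; last exact: bounded_mfun_integrable.
  by rewrite mulrC -A1; apply: eq_Rintegral => w _; rewrite mulrC.
have bV : bounded_mfun (fun w => (in_box J' V s' w)%:R : R).
  by rewrite natr_bool_indic; exact: bounded_mfun_indic.
have := agree_box P J' _ _ mV mV _ _ s' ag s0'.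
rewrite RintegralZr//; last exact: bounded_mfun_integrable.
rewrite Rintegral_bool// mulrC => <-.
under [RHS]eq_Rintegral do rewrite -natrM mulnb.
have -> : [set w | in_box J U s w] `&` [set w | in_box J' V s' w] =
   [set w | in_box J' V s' w && in_box J U s w].
  by apply/seteqP; split => w /=; [move=> [-> ->]|move=> /andP[]].
rewrite Rintegral_bool//.
have -> : [set w | in_box J' V s' w && in_box J U s w] =
  [set w | in_box J U s w] `&` [set w | in_box J' V s' w].
  by apply/seteqP; split => w /=; [move=> /andP[]|move=> [-> ->]].
exact: measurableI.
Qed.

End gaussian_family.

(** * Fernique's inequality for finite families *)

Section fernique.
Context {d} {T : measurableType d} {R : realType} (P : probability T R) (I : Type).
Variables (X : I -> T -> R) (K : I -> I -> R).
Hypothesis gX : centered_gaussian_family P X K.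
Hypothesis Ksym : forall i j, K i j = K j i.
Local Notation lin := (lincomb I X).
Local Notation pr := (pr P).
Local Notation cov := (cov I K).
Local Notation scal := (scal I).

Definition nbox (N : nat) (t : R) := [seq (j, t) | j <- iota 0 N].

Definition bounded_by (F : nat -> seq (R * I)) N t :=
  [set w | in_box nat (fun j => lin (F j)) (nbox N t) w].

Lemma bounded_byP F N t w :
  bounded_by F N t w <-> (forall j, (j < N)%N -> `|lin (F j) w| <= t).
Proof.
rewrite /bounded_by /in_box /nbox /= all_map; split => [/allP h j jN|h].
  by have := h j; rewrite mem_iota add0n leq0n jN; exact.
by apply/allP => j; rewrite mem_iota /= => jN; exact: h.
Qed.

Lemma measurable_bounded_by F N t : measurable (bounded_by F N t).
Proof. exact: (measurable_box P I X K gX). Qed.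

Let nbox_ge0 N t : 0 <= t -> all (fun p : nat * R => 0 <= p.2) (nbox N t).
Proof. by move=> t0; rewrite all_map; apply/allP. Qed.

Lemma bounded_by_eq F G N t : 0 <= t ->
  (forall j k, cov (F j) (F k) = cov (G j) (G k)) ->
  pr (bounded_by F N t) = pr (bounded_by G N t).
Proof.
by move=> t0 FG; apply: (gauss_box_eq P I X K gX Ksym) => //; exact: nbox_ge0.
Qed.

Lemma bounded_by_scale F G N t c : 0 < c -> 0 <= t ->
  (forall j k, cov (G j) (G k) = c ^+ 2 * cov (F j) (F k)) ->
  pr (bounded_by G N (c * t)) = pr (bounded_by F N t).
Proof.
move=> c0 t0 FG; rewrite (bounded_by_eq G (fun j => scal c (F j))).
- congr pr; apply/seteqP; split => w /bounded_byP h; apply/bounded_byP => j jN; have := h j jN;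
    by rewrite lin_scal normrM (gtr0_norm c0) ler_pM2l.
- by rewrite mulr_ge0// ltW.
- by move=> j k; rewrite FG cov_scall (cov_scalr I K Ksym) mulrA.
Qed.

Section two_copies.
Variables F G : nat -> seq (R * I).
Hypotheses (FG : forall j k, cov (F j) (F k) = cov (G j) (G k))
  (FG0 : forall j k, cov (F j) (G k) = 0).
Variable N : nat.
Local Notation p := (fun t => pr (bounded_by F N t)).

Let p_ge0 t : 0 <= p t. Proof. exact: pr_ge0. Qed.

Let p_le1 t : p t <= 1.
Proof. by apply: pr_le1; exact: measurable_bounded_by. Qed.

Let p_nd s t : s <= t -> p s <= p t.
Proof.
move=> st; apply: le_pr; [exact: measurable_bounded_by..|].
by move=> w /bounded_byP h; apply/bounded_byP => j jN; exact: le_trans (h j jN) st.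
Qed.

Let base (x : nat + nat) := match x with inl j => F j | inr j => G j end.

(** The pair [(F, G)] turned by 45 degrees; all covariances are preserved because those of [F] and
    [G] agree and the cross terms vanish. *)
Let rot (x : nat + nat) := match x with
  | inl j => scal (Num.sqrt 2)^-1 (F j ++ G j)
  | inr j => scal (Num.sqrt 2)^-1 (F j ++ scal (-1) (G j)) end.

Let sbox (s t : R) := [seq (inl j : nat + nat, t) | j <- iota 0 N] ++ [seq (inr j : nat + nat, s) | j <- iota 0 N].

Let sboxE (H : nat + nat -> seq (R * I)) s t :
  [set w | in_box (nat + nat) (fun j => lin (H j)) (sbox s t) w] =
  bounded_by (fun j => H (inl j)) N t `&` bounded_by (fun j => H (inr j)) N s.
Proof.
by apply/seteqP; split => w; rewrite /bounded_by /in_box /nbox /sbox /= all_cat !all_map => /andP.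
Qed.

Let sqrt2 : Num.sqrt 2 * Num.sqrt 2 = 2 :> R.
Proof. by rewrite -expr2 sqr_sqrtr. Qed.

Let sqrt2_gt0 : 0 < Num.sqrt 2 :> R. Proof. by rewrite sqrtr_gt0. Qed.

Let cov_rot x y : cov (base x) (base y) = cov (rot x) (rot y).
Proof.
have h : (Num.sqrt 2)^-1 * ((Num.sqrt 2)^-1 * 2) = 1 :> R.
  transitivity (2 / (Num.sqrt 2 * Num.sqrt 2) : R); last by rewrite sqrt2 divff.
  by rewrite invfM; ring.
have FG0' j k : cov (G j) (F k) = 0 by rewrite (cov_sym I K Ksym) FG0.
have e := (cov_catl I K, cov_scall I K, cov_catr I K, cov_scalr I K Ksym).
by case: x => j; case: y => k /=; rewrite !e ?FG0 ?FG0' -?FG;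
  move: h; set a := (Num.sqrt 2)^-1; set c := cov _ _; clearbody a c => h;
  first [ring | rewrite -[LHS]mulr1 -[X in _ * X = _]h; ring].
Qed.

(** The left side is the probability that the rotated differences stay within [s] while some rotated
    sum exceeds [t]. At that index [|x - y| <= s sqrt2] and [|x + y| > t sqrt2], which forces both
    [|x|] and [|y|] above [(t - s) / sqrt2]; independence of the copies gives the square. *)
Lemma fernique_ineq s t : 0 <= s -> s <= t ->
  p s * (1 - p t) <= (1 - p ((t - s) / Num.sqrt 2)) ^+ 2.
Proof.
move=> s0 st; have t0 : 0 <= t by exact: le_trans st.
set r := (t - s) / Num.sqrt 2.
have r0 : 0 <= r by rewrite divr_ge0 ?subr_ge0// ltW.
have pG u : 0 <= u -> pr (bounded_by G N u) = p u.
  by move=> u0; apply/esym/bounded_by_eq.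
have indep u u' : 0 <= u -> 0 <= u' ->
    pr (bounded_by F N u `&` bounded_by G N u') = p u * p u'.
  move=> u0 u0'; rewrite -(pG u')//; apply: (gauss_box_indep P I X K gX Ksym) => //; exact: nbox_ge0.
have rotE u u' : 0 <= u -> 0 <= u' ->
    pr (bounded_by F N u' `&` bounded_by G N u) =
    pr (bounded_by (fun j => rot (inl j)) N u' `&` bounded_by (fun j => rot (inr j)) N u).
  move=> u0 u0'; rewrite -(sboxE base) -(sboxE rot).
  apply: (gauss_box_eq P I X K gX Ksym) => //.
  by rewrite all_cat !all_map; apply/andP; split; apply/allP.
have rotE1 u : 0 <= u -> pr (bounded_by (fun j => rot (inr j)) N u) = p u.
  move=> u0; rewrite -pG//; apply/esym/bounded_by_eq => // j k; exact: (cov_rot (inr j) (inr k)).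
set A := bounded_by (fun j => rot (inr j)) N s.
set B := bounded_by (fun j => rot (inl j)) N t.
have mA : measurable A by exact: measurable_bounded_by.
have mB : measurable B by exact: measurable_bounded_by.
have -> : p s * (1 - p t) = pr (A `\` B).
  by rewrite pr_setD// rotE1// setIC -rotE// indep//; ring.
have mF := measurable_bounded_by F N r; have mG := measurable_bounded_by G N r.
have -> : (1 - p r) ^+ 2 = pr (~` bounded_by F N r `\` bounded_by G N r).
  rewrite pr_setD//; last exact: measurableC.
  rewrite setIC -setDE pr_setD// setIC pr_setC// indep// pG//; ring.
apply: le_pr; [exact: measurableD|by apply: measurableD => //; exact: measurableC|].
move=> w [/bounded_byP As /bounded_byP].
move=> /existsNP[j /not_implyP[jN /negP]]; rewrite -ltNge.
have := As j jN; rewrite /= !lin_scal !lin_cat lin_scal !normrM mulN1r.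
rewrite gtr0_norm ?invr_gt0// ler_pdivrMl// ltr_pdivlMl//.
set x := lin (F j) w; set y := lin (G j) w => h1 h2.
have rE : r * 2 = Num.sqrt 2 * (t - s).
  rewrite /r -[X in _ * X = _]sqrt2.
  by rewrite mulrA divfK ?gt_eqF// mulrC.
have xr : r < `|x|.
  have : `|x + y| <= `|x - y| + 2 * `|x| by rewrite (_ : x + y = - (x - y) + 2 * x); [|ring];
    rewrite (le_trans (ler_normD _ _))// normrN normrM (ger0_norm (ler0n _ 2)).
  by lra.
have yr : r < `|y|.
  have : `|x + y| <= `|x - y| + 2 * `|y| by rewrite (_ : x + y = (x - y) + 2 * y); [|ring];
    rewrite (le_trans (ler_normD _ _))// normrM (ger0_norm (ler0n _ 2)).
  by lra.
by split=> /bounded_byP /(_ j jN); rewrite leNgt ?xr ?yr.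
Qed.

(** The levels [t_k = s (4 sqrt2^k - 3)] satisfy [t_0 = s] and [(t_(k+1) - s) / sqrt2 >= t_k],
    because [2 sqrt2 <= 3]. Along them [fernique_ineq] squares the bound on [(1 - p t_k) / p s] at
    each step, while the level grows by a factor of about [sqrt2]. *)
Lemma fernique_iter s e k : 0 <= s -> 0 <= e <= 1 -> 1 - p s <= e / 2 ->
  1 - p (s * (4 * Num.sqrt 2 ^+ k - 3)) <= p s * e ^+ (2 ^ k).
Proof.
move=> s0 /andP[e0 e1] ps.
have ps0 : 2^-1 <= p s by lra.
elim: k => [|k IH].
  rewrite expr0 mulr1 expn0 expr1 (_ : 4 - 3 = 1 :> R) ?mulr1; last by ring.
  by apply: le_trans ps _; rewrite mulrC ler_wpM2r.
have g1 : 1 <= Num.sqrt 2 :> R by rewrite -[leLHS]sqrtr1 ler_sqrt; lra.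
set a := Num.sqrt 2 ^+ k in IH.
have a1 : 1 <= a by exact: exprn_ege1.
set t := s * (4 * Num.sqrt 2 ^+ k.+1 - 3).
have tE : t = s * (4 * (Num.sqrt 2 * a) - 3) by rewrite /t exprS.
have ga : 1 <= Num.sqrt 2 * a by exact: mulr_ege1.
have st : s <= t.
  have : 0 <= s * (Num.sqrt 2 * a - 1) by rewrite mulr_ge0// subr_ge0.
  by rewrite tE; lra.
have h := fernique_ineq s t s0 st.
have h2 : 1 - p ((t - s) / Num.sqrt 2) <= p s * e ^+ (2 ^ k).
  apply: le_trans IH; rewrite lerD2l lerN2; apply: p_nd.
  rewrite ler_pdivlMr// tE; move: sqrt2 => s2; have h4 : 4 <= Num.sqrt 2 * 3 :> R by nra.
  have : 0 <= s * (Num.sqrt 2 * 3 - 4) by rewrite mulr_ge0// subr_ge0.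
  by lra.
have h3 : p s * (1 - p t) <= p s * (p s * e ^+ (2 ^ k.+1)).
  apply: le_trans h _.
  have -> : p s * (p s * e ^+ (2 ^ k.+1)) = (p s * e ^+ (2 ^ k)) ^+ 2.
    by rewrite exprMn -exprM -expnSr expr2 mulrA.
  by apply: lerXn2r => //; rewrite nnegrE ?subr_ge0 ?p_le1// mulr_ge0 ?exprn_ge0.
by move: h3; rewrite ler_pM2l//; lra.
Qed.

Lemma fernique s M n : 0 <= s -> 0 <= M -> (0 < n)%N ->
  1 - p s <= expR (- (2 * M)) / 2 ->
  1 - p (4 * s * Num.sqrt n%:R) <= expR (- (n%:R * M)).
Proof.
move=> s0 M0 n0 ps.
have e01 : 0 <= expR (- (2 * M)) <= 1.
  by rewrite expR_ge0 -[leRHS]expR0 ler_expR oppr_le0 mulr_ge0.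
(* Since [2^k <= n < 2^(k+1)], the level stays below [4 s sqrt n], and the factor 2 lost in the
   exponent is covered by the [2 * M] of the hypothesis. *)
pose k := trunc_log 2 n.
have /andP[k1 k2] : (2 ^ k <= n < 2 ^ k.+1)%N by exact: trunc_log_bounds.
have := fernique_iter s _ k s0 e01 ps.
set u := s * _ => h.
have ut : u <= 4 * s * Num.sqrt n%:R.
  have : Num.sqrt 2 ^+ k <= Num.sqrt (n%:R : R).
    have -> : Num.sqrt 2 ^+ k = Num.sqrt (2 ^ k)%:R :> R.
      rewrite natrX; elim: k {k1 k2 h u} => [|k IH]; first by rewrite !expr0 sqrtr1.
      by rewrite !exprS IH sqrtrM.
    by rewrite ler_sqrt// ler_nat.
  by rewrite /u; nra.
apply: (@le_trans _ _ (1 - p u)); first by rewrite lerD2l lerN2; exact: p_nd.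
apply: le_trans h _; rewrite -expRM_natl.
apply: (@le_trans _ _ (expR ((2 ^ k)%:R * - (2 * M)))).
  by rewrite ler_piMl ?expR_ge0.
rewrite ler_expR mulrN lerN2 mulrA -natrM ler_wpM2r// ler_nat mulnC -expnS.
exact: ltnW.
Qed.

(** A sum of [n] independent copies has the law of [sqrt n] times one copy, so the level
    [4 s sqrt n] for one copy becomes linear in [n], as large deviations require. *)
Lemma fernique_sum (H : nat -> seq (R * I)) s M n : 0 <= s -> 0 <= M -> (0 < n)%N ->
  (forall j k, cov (H j) (H k) = n%:R * cov (F j) (F k)) ->
  1 - p s <= expR (- (2 * M)) / 2 ->
  1 - pr (bounded_by H N (4 * s * n%:R)) <= expR (- (n%:R * M)).
Proof.
move=> s0 M0 n0 HF ps.
have n0' : 0 < Num.sqrt (n%:R : R) by rewrite sqrtr_gt0 ltr0n.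
have n2 : Num.sqrt (n%:R : R) ^+ 2 = n%:R by rewrite sqr_sqrtr.
rewrite -[in leLHS]n2 (_ : 4 * s * _ = Num.sqrt n%:R * (4 * s * Num.sqrt n%:R)); last by ring.
rewrite (bounded_by_scale F)//; first exact: fernique.
- by rewrite !mulr_ge0.
- by move=> j k; rewrite n2.
Qed.

End two_copies.
End fernique.

(** * Oscillation and growth of the aggregate process *)

Section rationals.
Context {R : realType}.

(** Enumerates the rationals with repetitions: an index that codes no rational yields 0. Only
    density is used. *)
Definition qseq (i : nat) : R := ratr (odflt 0%Q (choice.unpickle i)).

Lemma qseq_dense (U : set R) : open U -> U !=set0 -> exists i, U (qseq i).
Proof.
move=> oU U0; have [x [Ux [r _ rx]]] := @dense_rat R _ U0 oU.
by exists (choice.pickle r); rewrite /qseq choice.pickleK/= rx.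
Qed.

End rationals.

Section process.
Context {R : realType} (v : R -> R) {d} {T : measurableType d} (P : probability T R).
Variable A : nat -> R -> T -> R.
Hypothesis v0 : v 0 = 0.
Hypothesis hA : iid_gaussian_copies P v A.
Local Notation pr := (pr P).

Definition Kiid (it ju : nat * R) : R := if it.1 == ju.1 then Gam v it.2 ju.2 else 0.

Local Notation I := (nat * R)%type.
Local Notation XA := (fun it : I => A it.1 it.2).
Local Notation lin := (lincomb I XA).
Local Notation cov := (cov I Kiid).
Local Notation scal := (scal I).
Local Notation bounded_by := (bounded_by I XA).

Lemma Gam_sym s t : Gam v s t = Gam v t s.
Proof. by rewrite /Gam distrC (addrC (v `|s|)). Qed.

Lemma GamN s t : Gam v (- s) (- t) = Gam v s t.
Proof. by rewrite /Gam !normrN opprK distrC (addrC s). Qed.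

Lemma Gam_diag t : Gam v t t = v `|t|.
Proof. by rewrite /Gam subrr normr0 v0; field. Qed.

Lemma Kiid_sym it ju : Kiid it ju = Kiid ju it.
Proof. by rewrite /Kiid eq_sym Gam_sym. Qed.

Lemma gA : centered_gaussian_family P XA Kiid.
Proof. by case: hA. Qed.

Let cA i w : continuous (fun t => A i t w).
Proof. by case: hA => _ [+ _]; exact. Qed.

Let cAN i w : continuous (fun t : R => A i (- t) w).
Proof.
move=> t; apply: (@continuous_comp _ _ _ (fun t : R => - t) (fun t => A i t w)); last exact: cA.
exact: (@cvgN _ R^o _ _ _ id t (@cvg_id _ _)).
Qed.

Let A0 i w : A i 0 w = 0.
Proof. by case: hA => _ [_ +]; exact. Qed.

(** Encodes [A_i(-t, 0)]; the term [A_i(0)] vanishes, so one entry suffices. *)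
Definition Al (i : nat) (t : R) : seq (R * I) := [:: (-1, (i, - t))].

Fixpoint Sl (n : nat) (t : R) : seq (R * I) := if n is m.+1 then Sl m t ++ Al m t else [::].

Definition Sn (n : nat) (t : R) (w : T) : R := \sum_(i < n) (A i 0 w - A i (- t) w).

Lemma lin_Al i t w : lin (Al i t) w = - A i (- t) w.
Proof. by rewrite /lincomb big_cons big_nil addr0 mulN1r. Qed.

Lemma lin_Sl n t w : lin (Sl n t) w = Sn n t w.
Proof.
elim: n => [|n IH]; first by rewrite /lincomb big_nil /Sn big_ord0.
by rewrite /= lin_cat IH lin_Al /Sn big_ord_recr/= A0 sub0r.
Qed.

Lemma cov_Al i j s t : cov (Al i s) (Al j t) = if i == j then Gam v s t else 0.
Proof.
rewrite /cov !(big_cons, big_nil) !addr0 /Kiid /= mulrNN !mul1r.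
by case: ifP => // _; rewrite GamN.
Qed.

Lemma cov_SlAl n m s t : (n <= m)%N -> cov (Sl n s) (Al m t) = 0.
Proof.
elim: n => [|n IH] nm; first by rewrite /cov big_nil.
by rewrite /= cov_catl IH ?(ltnW nm)// cov_Al (ltn_eqF nm) addr0.
Qed.

Lemma cov_Sl n s t : cov (Sl n s) (Sl n t) = n%:R * Gam v s t.
Proof.
elim: n => [|n IH]; first by rewrite /cov big_nil mul0r.
rewrite /= cov_catl !cov_catr IH cov_SlAl// (cov_sym I Kiid Kiid_sym (Al _ _)) cov_SlAl//.
by rewrite cov_Al eqxx addr0 add0r -natr1 mulrDl mul1r.
Qed.

Lemma Sn_continuous n w : continuous (fun t : R => Sn n t w).
Proof.
have -> : (fun t => Sn n t w) = \sum_(i < n) (fun t => A i 0 w - A i (- t) w).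
  by apply/funext => t; rewrite /Sn fct_sumE.
apply: (big_ind (fun f : R -> R => continuous f)).
- by move=> t; exact: cvg_cst.
- by move=> f g cf cg t; apply: (@cvgD _ R^o); [exact: cf|exact: cg].
- by move=> i _ t; apply: (@cvgB _ R^o); [exact: cvg_cst|exact: cAN].
Qed.

Lemma Sn0 n w : Sn n 0 w = 0.
Proof. by rewrite /Sn big1// => i _; rewrite oppr0 subrr. Qed.

Lemma measurable_Sn n t : measurable_fun setT (Sn n t).
Proof.
have -> : Sn n t = lin (Sl n t) by apply/funext => w; rewrite lin_Sl.
exact: (measurable_lin P I XA Kiid gA).
Qed.

Definition inc_one (i : nat) (a b : nat -> R) (j : nat) := Al i (a j) ++ scal (-1) (Al i (b j)).
Definition inc_sum (n : nat) (a b : nat -> R) (j : nat) := Sl n (a j) ++ scal (-1) (Sl n (b j)).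

Lemma lin_inc_one i a b j w : lin (inc_one i a b j) w = A i (- b j) w - A i (- a j) w.
Proof. by rewrite lin_cat lin_scal !lin_Al mulrNN mul1r addrC. Qed.

Lemma lin_inc_sum n a b j w : lin (inc_sum n a b j) w = Sn n (a j) w - Sn n (b j) w.
Proof. by rewrite lin_cat lin_scal !lin_Sl mulN1r. Qed.

(** Covariance of [A(-b) - A(-a)] and [A(-e) - A(-c)]. Only differences of times occur: this is
    stationarity of increments. *)
Definition inc_cov (a b c e : R) : R :=
  (v `|e - a| + v `|c - b| - v `|c - a| - v `|e - b|) / 2.

Let covs := (cov_catl I Kiid, cov_scall I Kiid, cov_catr I Kiid, cov_scalr I Kiid Kiid_sym).

Lemma cov_inc_one i i' a b a' b' j k : cov (inc_one i a b j) (inc_one i' a' b' k) =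
  if i == i' then inc_cov (a j) (b j) (a' k) (b' k) else 0.
Proof.
rewrite /inc_one !covs !cov_Al; case: ifP => _; last by ring.
by rewrite /Gam /inc_cov; field.
Qed.

Lemma cov_inc_sum n a b a' b' j k : cov (inc_sum n a b j) (inc_sum n a' b' k) =
  n%:R * inc_cov (a j) (b j) (a' k) (b' k).
Proof. by rewrite /inc_sum !covs !cov_Sl /Gam /inc_cov; field. Qed.

Lemma fernique_inc a b N s M n : 0 <= s -> 0 <= M -> (0 < n)%N ->
  1 - pr (bounded_by (inc_one 0 a b) N s) <= expR (- (2 * M)) / 2 ->
  1 - pr (bounded_by (inc_sum n a b) N (4 * s * n%:R)) <= expR (- (n%:R * M)).
Proof.
move=> s0 M0 n0 h.
apply: (fernique_sum P I XA Kiid gA Kiid_sym (inc_one 0 a b) (inc_one 1 a b)) => //.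
- by move=> j k; rewrite !cov_inc_one.
- by move=> j k; rewrite !cov_inc_one.
- by move=> j k; rewrite cov_inc_one cov_inc_sum.
Qed.

Lemma measurable_gt_inc i a b (s : R) : measurable [set w | s < `|A i (- b) w - A i (- a) w|].
Proof.
have -> : [set w | s < `|A i (- b) w - A i (- a) w|] =
    ~` bounded_by (inc_one i (fun=> a) (fun=> b)) 1 s.
  apply/seteqP; split => w /=.
    by move=> sw /bounded_byP/(_ 0 isT); rewrite lin_inc_one leNgt sw.
  move=> h; rewrite ltNge; apply/negP => h2; apply: h; apply/bounded_byP => j _.
  by rewrite lin_inc_one.
by apply: measurableC; exact: (measurable_bounded_by P I XA Kiid gA).
Qed.

(** Continuity from above: the events that some rational time of [D m] shows an excess decrease to
    the empty set, since each path is eventually good. As [D m] is open and paths are continuous, an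
    excess at any time of [D m] also shows at a rational one, which makes the bound uniform over
    finite families. *)
Lemma excess_small (D : nat -> set R) (s : nat -> R) (b e : R) : 0 < e ->
  (forall m, open (D m)) -> (forall m, D m.+1 `<=` D m) -> (forall m, s m <= s m.+1) ->
  (forall w, exists m, forall u, D m u -> `|A 0 (- b) w - A 0 (- u) w| <= s m) ->
  exists m, forall a N, (forall j, D m (a j)) ->
    1 - pr (bounded_by (inc_one 0 a (fun=> b)) N (s m)) <= e.
Proof.
move=> e0 oD ndD nds small.
pose B m := \bigcup_(i in [set i | D m (qseq i)])
  [set w | s m < `|A 0 (- b) w - A 0 (- qseq i) w|].
have mB m : measurable (B m).
  by apply: bigcup_measurable => i _; exact: measurable_gt_inc.
have ndB : nonincreasing_seq B.
  apply/nonincreasing_seqP => m; rewrite subsetEset => w [i /= Di sw].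
  by exists i => /=; [exact: ndD|exact: le_lt_trans sw].
have capB : \bigcap_m B m = set0.
  apply/seteqP; split => // w /= h; have [m hm] := small w.
  by have [i /= Di] := h m Logic.I; rewrite ltNge hm.
have := @nonincreasing_cvg_mu _ _ _ P B.
rewrite capB measure0 => /(_ _ mB _ ndB) cB.
have {}cB : P (B m) @[m --> \oo] --> 0%E.
  apply: cB => //.
  by rewrite -[ltLHS]/(P (B 0%N)) (le_lt_trans (probability_le1 P (mB 0%N)))// ltry.
have /fine_cvgP[_ /cvgrPdist_lt /(_ e e0)[m _ hm]] := cB.
exists m => a N Da; have {hm} := hm m (leqnn m).
rewrite /= sub0r normrN ger0_norm; last exact: (pr_ge0 P).
move=> hm; rewrite -pr_setC; last exact: (measurable_bounded_by P I XA Kiid gA).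
apply: le_trans (ltW hm).
apply: le_pr => //; first by apply: measurableC; exact: (measurable_bounded_by P I XA Kiid gA).
move=> w /= h; apply: contrapT => nB; apply: h; apply/bounded_byP => j _.
rewrite lin_inc_one leNgt; apply/negP => sw.
pose U := D m `&` [set u | s m < `|A 0 (- b) w - A 0 (- u) w|].
have oU : open U.
  apply: openI => //.
  have -> : [set u | s m < `|A 0 (- b) w - A 0 (- u) w|] =
    (fun u => `|A 0 (- b) w - A 0 (- u) w|) @^-1` [set y | s m < y] by [].
  apply: open_comp; last exact: open_gt.
  move=> u _; apply: cvg_norm; apply: (@cvgB _ R^o); [exact: cvg_cst|exact: cAN].
have [i [Di si]] := qseq_dense U oU (ex_intro _ _ (conj (Da j) sw)).
by apply: nB; exists i.
Qed.

Lemma local_oscillation (t e M : R) : 0 < e -> 0 <= M ->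
  exists2 dl : R, 0 < dl & forall a N n, (forall j, `|t - a j| < dl) -> (0 < n)%N ->
    1 - pr (bounded_by (inc_sum n a (fun=> t)) N (e * n%:R)) <= expR (- (n%:R * M)).
Proof.
move=> e0 M0.
(* The level is constant and the balls shrink. It is [e / 4] because [fernique_inc] multiplies
   levels by 4. *)
have [//| | | |w|m hm] := @excess_small (fun m => ball t m.+1%:R^-1) (fun=> e / 4) t (expR (- (2 * M)) / 2).
- by rewrite divr_gt0// expR_gt0.
- by move=> m; exact: ball_open.
- move=> m u; rewrite /ball/= => h; apply: (lt_le_trans h).
  by rewrite lef_pV2 ?posrE// ler_nat.
- by [].
- have := cAN 0 w t; move=> /cvgrPdist_lt /(_ (e / 4)).
  rewrite divr_gt0// => /(_ isT) /nbhs_ballP[r /= r0 hr].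
  have [m hm] : exists m : nat, m.+1%:R^-1 < r.
    exists (Num.truncn r^-1); rewrite invf_plt ?posrE//; exact: truncnS_gt.
  exists m => u hu; apply: ltW; apply: hr.
  by move: hu; rewrite /ball/= => /lt_trans; apply.
exists m.+1%:R^-1 => // a N n ha n0.
have -> : e * n%:R = 4 * (e / 4) * n%:R by field.
by apply: fernique_inc => //; [rewrite ltW// divr_gt0|exact: hm].
Qed.

Lemma unit_excess : exists2 s : R, 0 < s & forall a N, (forall j, 0 <= a j <= 1) ->
  1 - pr (bounded_by (inc_one 0 a (fun=> 0)) N s) <= expR (- (2 * 1)) / 2.
Proof.
(* The set is fixed and the level grows. Radius 2 places [[0, 1]] in an open set with compact
   closure. *)
have [| | | |w|m hm] := @excess_small (fun=> ball (0 : R) 2) (fun m => m.+1%:R) 0 (expR (- (2 * 1)) / 2).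
- by rewrite divr_gt0// expR_gt0.
- by move=> m; exact: ball_open.
- by move=> m u.
- by move=> m; rewrite ler_nat.
- have cf : {within `[-2, 2], continuous (fun u : R => A 0 (- u) w)}.
    by apply: continuous_subspaceT; exact: cAN.
  have l22 : -2 <= 2 :> R by lra.
  have [c _ hc] := EVT_max l22 cf.
  have [c' _ hc'] := EVT_min l22 cf.
  pose C := `|A 0 (- c) w| + `|A 0 (- c') w|.
  exists (Num.truncn C) => u; rewrite /ball/= sub0r normrN => hu.
  rewrite oppr0 A0 sub0r normrN; apply: (@le_trans _ _ C); last first.
    by apply: ltW; exact: truncnS_gt.
  have uI : u \in `[-2, 2] by rewrite in_itv/= -ler_norml ltW.
  have := hc u uI; have := hc' u uI; rewrite /C ler_norml.
  have := ler_norm (A 0 (- c) w); have := ler_norm (- A 0 (- c') w); rewrite normrN.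
  have := normr_ge0 (A 0 (- c) w); have := normr_ge0 (A 0 (- c') w).
  lra.
exists m.+1%:R => // a N ha; apply: hm => j.
by rewrite /ball/= sub0r normrN ltr_norml; have := ha j; lra.
Qed.

End process.

(** * Growth of the aggregate process at infinity *)

Section tail.
Context {R : realType} (v : R -> R) {d} {T : measurableType d} (P : probability T R).
Variable A : nat -> R -> T -> R.
Hypothesis v0 : v 0 = 0.
Hypothesis v_growth : exists alpha : R, alpha < 2 /\
      (fun t => v t / t `^ alpha) @ +oo --> (0 : R).
Hypothesis hA : iid_gaussian_copies P v A.
Local Notation pr := (pr P).
Local Notation I := (nat * R)%type.
Local Notation XA := (fun it : I => A it.1 it.2).
Local Notation lin := (lincomb I XA).
Local Notation Kiid := (Kiid v).
Local Notation cov := (cov I Kiid).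
Local Notation scal := (scal I).
Local Notation bounded_by := (bounded_by I XA).
Local Notation Sn := (Sn A).
Let gA := gA v P A hA.
Let Ksym := Kiid_sym v.

Lemma pr_bigU (J : eqType) (E : J -> set T) (r : seq J) : (forall i, measurable (E i)) ->
  pr (\big[setU/set0]_(i <- r) E i) <= \sum_(i <- r) pr (E i).
Proof.
move=> mE; elim: r => [|i r IH]; first by rewrite !big_nil pr_set0.
rewrite !big_cons (le_trans (pr_setU _ _ _ _ _))//.
  by apply: bigsetU_measurable.
by rewrite lerD2l.
Qed.

Lemma measurable_lin_ge L (x : R) : measurable [set w | x <= lin L w].
Proof.
rewrite -[X in measurable X]setTI.
have -> : [set w | x <= lin L w] = lin L @^-1` `[x, +oo[%classic.
  by apply/seteqP; split => w /=; rewrite in_itv/= andbT.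
exact: (measurable_lin P I XA Kiid gA).
Qed.

Lemma chernoff_Sn n t (la x : R) : 0 < la -> 0 <= t ->
  pr [set w | n%:R * x <= lin (Sl n t) w] <= expR (- (n%:R * (la * x - la ^+ 2 * v t / 2))).
Proof.
move=> la0 t0.
have -> : [set w | n%:R * x <= lin (Sl n t) w] =
   [set w | la * (n%:R * x) <= lin (scal la (Sl n t)) w].
  by apply/seteqP; split => w /=; rewrite lin_scal ler_pM2l.
apply: le_trans (lin_tail P I XA Kiid gA Ksym _ _) _.
rewrite cov_scall (cov_scalr I Kiid Ksym) cov_Sl (Gam_diag v v0) ger0_norm// ler_expR.
by rewrite le_eqVlt; apply/orP; left; apply/eqP; field.
Qed.

(** Fernique's bound with [n * m] in place of [n], where [m] is about [C k^2]: the level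
    [4 s sqrt(n m)] for one copy is [4 s n sqrt m <= n c k] for the sum, and the exponent is [n m].
    Stationarity moves [[k, k+1]] to [[0, 1]], so [C] does not depend on [k]. *)
Lemma unit_block (c : R) : 0 < c -> exists2 C : R, 0 < C &
  forall (k n : nat) (a : nat -> R) N, (0 < n)%N -> (forall j, k%:R <= a j <= k%:R + 1) ->
  1 - pr (bounded_by (inc_sum n a (fun=> k%:R)) N (n%:R * (c * k%:R))) <=
  expR (- (n%:R * (C * k%:R ^+ 2 - 1))).
Proof.
move=> c0; have [s s0 hs] := unit_excess v P A hA.
exists ((c / (4 * s)) ^+ 2); first by rewrite exprn_gt0// divr_gt0// mulr_gt0.
move=> k n a N n0 ak.
set y := (c / (4 * s)) ^+ 2 * k%:R ^+ 2.
have y0 : 0 <= y by rewrite mulr_ge0 ?sqr_ge0.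
pose m := Num.truncn y.
have my : m%:R <= y by rewrite truncn_le.
have ym : y < m.+1%:R by exact: truncnS_gt.
(* If [m = 0] then [y < 1], and the claimed bound is at least 1. *)
have [m0|m0] := posnP m.
  apply: (@le_trans _ _ 1); first by rewrite gerBl pr_ge0.
  rewrite -[leLHS]expR0 ler_expR oppr_ge0 mulr_ge0_le0// subr_le0 ltW//.
  by move: ym; rewrite m0.
pose F i := inc_one i (fun j => a j - k%:R) (fun=> 0 : R).
have covF i i' j l : cov (F i j) (F i' l) =
    if i == i' then inc_cov v (a j) k%:R (a l) k%:R else 0.
  rewrite cov_inc_one; case: ifP => // _; rewrite /inc_cov.
  have -> : 0 - (a j - k%:R) = k%:R - a j by ring.
  have -> : a l - k%:R - 0 = a l - k%:R by ring.
  have -> : a l - k%:R - (a j - k%:R) = a l - a j by ring.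
  by rewrite !subrr.
have nm0 : (0 < n * m)%N by rewrite muln_gt0 n0.
have h : 1 - pr (bounded_by (F 0) N (4 * s * Num.sqrt (n * m)%:R)) <= expR (- ((n * m)%:R * 1)).
  apply: (fernique P I XA Kiid gA Ksym (F 0) (F 1)).
  - by move=> j l; rewrite !covF.
  - by move=> j l; rewrite !covF.
  - exact: ltW.
  - exact: ler01.
  - exact: nm0.
  - by apply: hs => j; have := ak j; lra.
have n0' : 0 < Num.sqrt (n%:R : R) by rewrite sqrtr_gt0 ltr0n.
have u0 : 0 <= 4 * s * Num.sqrt ((n * m)%:R : R) by rewrite !mulr_ge0// ltW.
have E : pr (bounded_by (inc_sum n a (fun=> k%:R)) N
      (Num.sqrt n%:R * (4 * s * Num.sqrt (n * m)%:R))) =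
    pr (bounded_by (F 0) N (4 * s * Num.sqrt (n * m)%:R)).
  apply: (bounded_by_scale P I XA Kiid gA Ksym) => // j l.
  by rewrite sqr_sqrtr// covF cov_inc_sum.
apply: (@le_trans _ _ (expR (- ((n * m)%:R * 1)))); last first.
  rewrite ler_expR lerN2 mulr1 natrM ler_wpM2l//.
  by move: ym; rewrite -natr1; lra.
apply: le_trans h; rewrite lerD2l lerN2 -E.
apply: le_pr; [exact: (measurable_bounded_by P I XA Kiid gA)..|].
move=> w /bounded_byP hw; apply/bounded_byP => j jN; apply: le_trans (hw j jN) _.
have -> : Num.sqrt n%:R * (4 * s * Num.sqrt (n * m)%:R) = n%:R * (4 * s * Num.sqrt m%:R).
  rewrite natrM sqrtrM//.
  transitivity (Num.sqrt n%:R * Num.sqrt n%:R * (4 * s * Num.sqrt m%:R)); first by ring.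
  by rewrite -expr2 sqr_sqrtr.
rewrite ler_wpM2l//.
have : Num.sqrt m%:R <= c / (4 * s) * k%:R.
  have ck : 0 <= c / (4 * s) * k%:R by rewrite mulr_ge0// divr_ge0 ?ltW// mulr_gt0.
  rewrite -[leRHS](ger0_norm ck) -sqrtr_sqr ler_sqrt ?sqr_ge0//.
  by rewrite exprMn.
have s4 : 0 < 4 * s by rewrite mulr_gt0.
by rewrite mulrAC ler_pdivlMr// mulrC.
Qed.

(** The two rates are those of a block's oscillation and of its left endpoint. The surplus
    [ln 2 + 2 ln (k+1)] over [M] pays for the sum over all blocks. *)
Lemma tail_rate (c C M : R) : 0 < c -> 0 < C -> 0 <= M ->
  exists2 k0 : nat, (0 < k0)%N & forall k, (k0 <= k)%N ->
    M + ln 2 + 2 * ln k.+1%:R <= C * k%:R ^+ 2 - 1 /\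
    exists2 la : R, 0 < la & M + ln 2 + 2 * ln k.+1%:R <= la * (c * k%:R) - la ^+ 2 * v k%:R / 2.
Proof.
move=> c0 C0 M0; have [al [al2 vg]] := v_growth.
pose be := 2 - al.
have be0 : 0 < be by rewrite subr_gt0.
have ln2 : 0 <= (ln 2 : R) <= 1.
  rewrite ln_ge0 ?ler1n//=.
  have := @le_ln1Dx R 1; rewrite (_ : 1 + 1 = 2); last by ring.
  by apply; lra.
have [B [_ hB]] : \forall t \near +oo, v t / t `^ al < 1.
  by have := vg; move=> /cvgrPdist_lt /(_ 1 ltr01); apply: filterS => t; rewrite sub0r normrN; exact: le_lt_trans (ler_norm _).
(* With [L = ln k], the quadratic part of the exponential makes the second rate at least
   [c^2 be^2 L^2 / 4], which is at least [(M + 6) L] beyond [L0]. The 6 generously absorbs the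
   logarithms and the [- 1]. *)
pose L0 := 1 + 4 / (c ^+ 2 * be ^+ 2) * (M + 6).
pose r := 1 + `|B| + (M + 6) / C + expR L0.
exists (Num.truncn r).+1 => // k kr.
have rk : r < k%:R by apply: lt_le_trans (truncnS_gt r) _; rewrite ler_nat.
have p1 : 0 <= (M + 6) / C by rewrite divr_ge0//; lra.
have p2 := expR_gt0 L0.
have p3 := normr_ge0 B.
have k1 : 1 < k%:R :> R by move: rk; rewrite /r; lra.
have kB : B < k%:R by have := ler_norm B; move: rk; rewrite /r; lra.
have k0 : 0 < k%:R :> R by lra.
have kC : (M + 6) <= C * k%:R.
  by rewrite mulrC -ler_pdivrMr//; move: rk; rewrite /r; lra.
have kL : L0 <= ln k%:R.
  by rewrite -[leLHS]expRK ler_ln ?posrE//; move: rk; rewrite /r; lra.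
have lnk1 : ln k.+1%:R <= ln k%:R + 1 :> R.
  apply: (@le_trans _ _ (ln (2 * k%:R))).
    by rewrite ler_ln ?posrE// ?mulr_gt0// -natr1; lra.
  by rewrite lnM ?posrE//; lra.
have lnk : ln k%:R <= k%:R :> R.
  have := @le_ln1Dx R (k%:R - 1); rewrite (_ : 1 + (k%:R - 1) = k%:R); last by ring.
  by move=> /(_ _); lra.
split.
  have : (M + 6) * k%:R <= C * k%:R * k%:R by rewrite ler_pM2r.
  have : M * 1 <= M * k%:R by rewrite ler_wpM2l// ltW.
  by rewrite expr2 mulrA; lra.
set L := ln k%:R in kL lnk1 lnk *.
have kE : k%:R = expR L :> R by rewrite lnK// posrE.
(* This is [c k^(1 - al)]: as [v k <= k^al], the quadratic term removes at most half of the linear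
   term [c^2 k^(2 - al)]. *)
exists (c * expR ((1 - al) * L)); first by rewrite mulr_gt0// expR_gt0.
have vk : v k%:R <= expR (al * L).
  have := hB _ kB; rewrite /powR gt_eqF//= ltr_pdivrMr ?expR_gt0// mul1r => /ltW.
  by [].
have e1 : c * expR ((1 - al) * L) * (c * k%:R) = c ^+ 2 * expR (be * L).
  rewrite kE mulrACA -expr2 -expRD; congr (_ * expR _); rewrite /be; ring.
have e2 : (c * expR ((1 - al) * L)) ^+ 2 * v k%:R <= c ^+ 2 * expR (be * L).
  apply: (@le_trans _ _ ((c * expR ((1 - al) * L)) ^+ 2 * expR (al * L))).
    by rewrite ler_wpM2l// sqr_ge0.
  rewrite exprMn -mulrA (expr2 (expR _)) -!expRD le_eqVlt; apply/orP; left; apply/eqP.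
  by congr (_ * expR _); rewrite /be; ring.
have L1 : 1 <= L.
  have : 0 <= 4 / (c ^+ 2 * be ^+ 2) * (M + 6).
    by rewrite mulr_ge0 ?divr_ge0 ?mulr_ge0 ?sqr_ge0//; lra.
  by move: kL; rewrite /L0; lra.
have e3 : 1 + (be * L) ^+ 2 / 2 <= expR (be * L).
  by apply: (@expR_ge1Dxn R _ 1); rewrite mulr_ge0 ?(ltW be0)//; lra.
have cb : 0 < c ^+ 2 * be ^+ 2 by rewrite mulr_gt0// exprn_gt0.
have e4 : 4 * (M + 6) <= c ^+ 2 * be ^+ 2 * L.
  rewrite mulrC -ler_pdivrMl// mulrCA mulrC -mulrA.
  by move: kL; rewrite /L0 (mulrC _^-1) mulrA; lra.
have e5 : 4 * (M + 6) * L <= c ^+ 2 * be ^+ 2 * L * L by rewrite ler_wpM2r//; lra.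
have e6 : c ^+ 2 * (1 + (be * L) ^+ 2 / 2) <= c ^+ 2 * expR (be * L).
  by rewrite ler_wpM2l// sqr_ge0.
have e7 : M * 1 <= M * L by rewrite ler_wpM2l.
have c2 : 0 <= c ^+ 2 by rewrite sqr_ge0.
rewrite e1.
have e8 : c ^+ 2 * (1 + (be * L) ^+ 2 / 2) = c ^+ 2 + c ^+ 2 * be ^+ 2 * L * L / 2 by field.
move: e6; rewrite e8; move: (c ^+ 2 * expR (be * L)) e2 => E e2 e6.
lra.
Qed.

(** If [S_n(t) >= n c t] with [t] in [[k, k+1]], then either [S_n(k) >= n c k / 2], a Chernoff
    event, or the increment over the block is as large, an event for [unit_block]. *)
Lemma tail_bound (c M : R) : 0 < c -> 0 <= M ->
  exists2 k0 : nat, (0 < k0)%N & forall (n : nat) (a : nat -> R) N, (0 < n)%N ->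
  exists W, [/\ measurable W, pr W <= expR (- (n%:R * M)) &
    forall w j, (j < N)%N -> k0%:R <= a j -> n%:R * (c * a j) <= Sn n (a j) w -> W w].
Proof.
move=> c0 M0.
have c20 : 0 < c / 2 by rewrite divr_gt0.
have [C C0 hC] := unit_block (c / 2) c20.
have [k0 k00 hk] := tail_rate (c / 2) C M c20 C0 M0.
exists k0 => // n a N n0.
(* Times outside block [k] are moved to its left endpoint, where the increment is 0, so that all
   indices [j] stay in the family. *)
pose ak (k j : nat) : R := if k%:R <= a j <= k%:R + 1 then a j else k%:R.
pose E1 (k : nat) := [set w | n%:R * (c / 2 * k%:R) <= lin (Sl n k%:R) w].
pose E2 (k : nat) := ~` bounded_by (inc_sum n (ak k) (fun=> k%:R)) N (n%:R * (c / 2 * k%:R)).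
have mE1 k : measurable (E1 k) by exact: measurable_lin_ge.
have mE2 k : measurable (E2 k).
  by apply: measurableC; exact: (measurable_bounded_by P I XA Kiid gA).
pose K := (\max_(j < N) Num.truncn (a j)).+1.
exists (\big[setU/set0]_(k <- index_iota k0 K) (E1 k `|` E2 k)); split.
- by apply: bigsetU_measurable => k _; exact: measurableU.
- apply: (@le_trans _ _ (\sum_(k <- index_iota k0 K) (expR (- (n%:R * M)) * (k%:R^-1 - k.+1%:R^-1)))).
    apply: le_trans (pr_bigU _ _ _ _) _; first by move=> k; exact: measurableU.
    rewrite big_seq [leRHS]big_seq; apply: ler_sum => k.
    rewrite mem_index_iota => /andP[k0k _].
    have kp : 0 < k%:R :> R by rewrite ltr0n (leq_trans k00).
    have [h1 [la la0 h2]] := hk k k0k.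
    (* [exp(- ln 2 - 2 ln (k+1)) = 1 / (2 (k+1)^2)] is at most half of [1/k - 1/(k+1)], so the union
       bound telescopes. *)
    have fin (x : R) : M + ln 2 + 2 * ln k.+1%:R <= x ->
        expR (- (n%:R * x)) <= expR (- (n%:R * M)) * (k%:R^-1 - k.+1%:R^-1) / 2.
      move=> hx; apply: (@le_trans _ _ (expR (- (n%:R * M)) * expR (- (ln 2 + 2 * ln k.+1%:R)))).
        rewrite -expRD ler_expR.
        have n1 : 1 <= n%:R :> R by rewrite ler1n.
        have l1 : 0 <= ln k.+1%:R :> R by rewrite ln_ge0// ler1n.
        have l2 : 0 <= ln 2 :> R by rewrite ln_ge0// ler1n.
        have : n%:R * (M + ln 2 + 2 * ln k.+1%:R) <= n%:R * x by rewrite ler_wpM2l.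
        have : 1 * (ln 2 + 2 * ln k.+1%:R) <= n%:R * (ln 2 + 2 * ln k.+1%:R) :> R.
          by apply: ler_wpM2r => //; lra.
        by lra.
      rewrite -mulrA ler_wpM2l ?expR_ge0//.
      rewrite expRN expRD lnK ?posrE// expRM_natl lnK ?posrE//.
      have -> : k%:R^-1 - k.+1%:R^-1 = (k%:R * k.+1%:R)^-1 :> R.
        by rewrite -natr1; field; rewrite natr1 gt_eqF// gt_eqF.
      rewrite -invfM lef_pV2 ?posrE ?mulr_gt0 ?exprn_gt0//.
      have kk : k%:R <= k.+1%:R :> R by rewrite ler_nat.
      have kk0 : 0 <= k.+1%:R :> R by [].
      by have := ler_wpM2r kk0 kk; rewrite expr2; lra.
    apply: le_trans (pr_setU _ _ _ (mE1 k) (mE2 k)) _.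
    have b1 : pr (E1 k) <= expR (- (n%:R * M)) * (k%:R^-1 - k.+1%:R^-1) / 2.
      by apply: le_trans (fin _ h2); apply: chernoff_Sn => //; exact: ltW.
    have b2 : pr (E2 k) <= expR (- (n%:R * M)) * (k%:R^-1 - k.+1%:R^-1) / 2.
      rewrite pr_setC; last exact: (measurable_bounded_by P I XA Kiid gA).
      apply: le_trans (fin _ h1); apply: hC => // j.
      by rewrite /ak; case: ifP => // _; lra.
    by rewrite [leRHS]splitr lerD.
  rewrite -mulr_sumr ler_piMr ?expR_ge0//.
  have [Kk|kK] := leqP K k0; first by rewrite big_geq.
  have -> : \sum_(k0 <= k < K) (k%:R^-1 - k.+1%:R^-1 : R) = k0%:R^-1 - K%:R^-1.
    rewrite -[RHS]opprB -(telescope_sumr (fun k => (k%:R : R)^-1) (ltnW kK)) -sumrN.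
    by apply: eq_bigr => k _; rewrite opprB.
  have : k0%:R^-1 <= 1 :> R by rewrite invf_le1 ?ler1n// ltr0n.
  have : 0 <= K%:R^-1 :> R by rewrite invr_ge0.
  by lra.
- move=> w j jN kj Sj.
  have aj0 : 0 <= a j by apply: le_trans kj.
  have /andP[t1 t2] := truncn_itv aj0.
  set k := Num.truncn (a j) in t1 t2.
  have k0k : (k0 <= k)%N by rewrite truncn_ge_nat.
  have kK : (k < K)%N by rewrite ltnS; exact: (leq_bigmax (Ordinal jN)).
  have kI : k \in index_iota k0 K by rewrite mem_index_iota k0k.
  rewrite -bigcup_seq; exists k => //=.
  have [h|h] := leP (n%:R * (c / 2 * k%:R)) (Sn n k%:R w).
    by left; rewrite /E1 /= (lin_Sl v P A hA).
  right => /bounded_byP /(_ j jN); rewrite (lin_inc_sum v P A hA) /ak t1 -natr1 in t2 *.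
  rewrite (ltW t2)/=; apply/negP; rewrite -ltNge; apply: lt_le_trans (ler_norm _).
  have : n%:R * (c * k%:R) <= n%:R * (c * a j) by rewrite ler_wpM2l// ler_wpM2l// ltW.
  move: h Sj; have -> : n%:R * (c / 2 * k%:R) = n%:R * (c * k%:R) / 2 by field.
  by lra.
Qed.

End tail.

(** * Chernoff bounds near one time and covering of the time axis *)

Section covering.
Context {R : realType} (v : R -> R) {d} {T : measurableType d} (P : probability T R).
Variable A : nat -> R -> T -> R.
Hypothesis v0 : v 0 = 0.
Hypothesis v_growth : exists alpha : R, alpha < 2 /\
      (fun t => v t / t `^ alpha) @ +oo --> (0 : R).
Hypothesis hA : iid_gaussian_copies P v A.
Variables b c1 c2 : R.
Hypotheses (hb : 0 < b) (hc2 : 0 < c2) (hc12 : c2 < c1).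
Local Notation pr := (pr P).
Local Notation I := (nat * R)%type.
Local Notation XA := (fun it : I => A it.1 it.2).
Local Notation lin := (lincomb I XA).
Local Notation Kiid := (Kiid v).
Local Notation cov := (cov I Kiid).
Local Notation scal := (scal I).
Local Notation bounded_by := (bounded_by I XA).
Local Notation Sn := (Sn A).
Let gA := gA v P A hA.
Let Ksym := Kiid_sym v.

(* Variance of [x A(-t,0) + y (A(-t,0) - A(-s,0))]. *)
Definition pair_var (s t x y : R) : R :=
  (x + y) ^+ 2 * Gam v t t - 2 * (x + y) * y * Gam v s t + y ^+ 2 * Gam v s s.

(** [x] and [y] are the multipliers of the constraints at 0 and at [s]. The strict inequality leaves
    the slack that is spent on moving [t]. *)
Definition dual_gt (s t M : R) := exists x y, [/\ 0 <= x, 0 <= y &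
  M < x * (b + c2 * t) + y * (b + c2 * t - c1 * s) - pair_var s t x y / 2].

Lemma local_bound s t M : 0 <= M -> dual_gt s t M ->
  exists2 dl : R, 0 < dl & forall n (a : nat -> R) N, (0 < n)%N ->
  exists W, [/\ measurable W, pr W <= 2 * expR (- (n%:R * M)) &
    forall w j, (j < N)%N -> `|t - a j| < dl ->
      n%:R * (b + c2 * a j) <= Sn n (a j) w ->
      n%:R * (b + c2 * a j - c1 * s) <= Sn n (a j) w - Sn n s w -> W w].
Proof.
move=> M0 [x [y [x0 y0 hM]]].
set g := _ - _ in hM.
(* Half of the slack absorbs the oscillation of [S_n] near [t], which enters with weight [x + y],
   and half the change of drift [c2 (t - a j)]. The [+ 1] in the denominators covers [x + y = 0]. *)
pose e0 := g - M; have e00 : 0 < e0 by rewrite subr_gt0.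
pose th := x + y; have th0 : 0 <= th by rewrite addr_ge0.
pose e := e0 / (2 * (th + 1)).
have th1 : 0 < 2 * (th + 1) by lra.
have e1 : 0 < e by rewrite divr_gt0.
have [dl dl0 hdl] := local_oscillation v P A hA t e M e1 M0.
have thc : 0 < 2 * (th * c2 + 1) by have := mulr_ge0 th0 (ltW hc2); lra.
pose de := e0 / (2 * (th * c2 + 1)).
have de0 : 0 < de by rewrite divr_gt0.
exists (Num.min dl de); first by rewrite lt_min dl0.
move=> n a N n0.
(* Times away from [t] are replaced by [t], which adds a zero increment. *)
pose a' j := if `|t - a j| < dl then a j else t.
pose L := scal th (Sl n t) ++ scal (- y) (Sl n s).
pose W1 := [set w | n%:R * (x * (b + c2 * t) + y * (b + c2 * t - c1 * s) - e0) <= lin L w].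
pose W2 := ~` bounded_by (inc_sum n a' (fun=> t)) N (e * n%:R).
have mW1 : measurable W1 by exact: (measurable_lin_ge v P A hA).
have mbb : measurable (bounded_by (inc_sum n a' (fun=> t)) N (e * n%:R)).
  exact: (measurable_bounded_by P I XA Kiid gA).
have mW2 : measurable W2 by exact: measurableC.
exists (W1 `|` W2); split; first exact: measurableU.
  apply: le_trans (pr_setU _ _ _ mW1 mW2) _.
  have : pr W2 <= expR (- (n%:R * M)).
    rewrite pr_setC//; apply: hdl => // j.
    by rewrite /a'; case: ifP => // _; rewrite subrr normr0.
  suff : pr W1 <= expR (- (n%:R * M)) by lra.
  apply: le_trans (lin_tail P I XA Kiid gA Ksym _ _) _.
  have -> : cov L L = n%:R * pair_var s t x y.
    rewrite /L !(cov_catl, cov_catr, cov_scall, cov_scalr I Kiid Ksym) !cov_Sl.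
    by rewrite (Gam_sym v t s) /pair_var /th; ring.
  by rewrite ler_expR /e0 /g le_eqVlt; apply/orP; left; apply/eqP; field.
move=> w j jN; rewrite lt_min => /andP[tdl tde] h1 h2.
have [osc|osc] := leP `|Sn n (a j) w - Sn n t w| (e * n%:R); last first.
  right => /bounded_byP /(_ j jN); rewrite (lin_inc_sum v P A hA) /a' tdl.
  by rewrite leNgt osc.
left; rewrite /W1 /= lin_cat !lin_scal !(lin_Sl v P A hA).
have nn : 0 <= n%:R :> R by [].
move: osc; rewrite ler_norml => /andP[_ osc].
have k1 : x * (n%:R * (b + c2 * a j)) <= x * Sn n (a j) w by rewrite ler_wpM2l.
have k2 : y * (n%:R * (b + c2 * a j - c1 * s)) <= y * (Sn n (a j) w - Sn n s w) by rewrite ler_wpM2l.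
have k3 : th * (Sn n (a j) w - Sn n t w) <= th * (e * n%:R) by rewrite ler_wpM2l.
have k4 : th * e <= e0 / 2.
  by rewrite /e mulrA ler_pdivrMr//; have := mulr_ge0 (ltW e00) th0; lra.
have k5 : th * c2 * de <= e0 / 2.
  by rewrite /de mulrA ler_pdivrMr//; have := mulr_ge0 (ltW e00) (mulr_ge0 th0 (ltW hc2)); lra.
have k6 : n%:R * (th * e) <= n%:R * (e0 / 2) by rewrite ler_wpM2l.
have k7 : th * c2 * (t - a j) <= e0 / 2.
  apply: le_trans k5; rewrite ler_wpM2l ?mulr_ge0 ?(ltW hc2)//.
  exact: le_trans (ler_norm _) (ltW tde).
have k8 : n%:R * (th * c2 * (t - a j)) <= n%:R * (e0 / 2) by rewrite ler_wpM2l.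
move: k1 k2 k3 k6 k8; rewrite /th; lra.
Qed.

(** Centres, radii and [k0] are chosen before [n], so the size of the finite subcover enters the
    constant [C] only. *)
Lemma cover_bound (t0 M : R) : 0 <= M -> 0 <= t0 ->
  (forall t, t0 <= t -> exists s, [/\ 0 < s & dual_gt s t M]) ->
  exists2 C : R, 0 < C & forall n (a : nat -> R) N, (0 < n)%N ->
  exists W, [/\ measurable W, pr W <= C * expR (- (n%:R * M)) &
    forall w j, (j < N)%N -> t0 <= a j ->
      (forall s, 0 <= s -> n%:R * (b + c2 * a j - c1 * s) <= Sn n (a j) w - Sn n s w) -> W w].
Proof.
move=> M0 t00 hD.
have [k0 k00 htail] := tail_bound v P A v0 v_growth hA c2 M hc2 M0.
have /choice[f hf] : forall t : R, exists p : R * R, t0 <= t -> [/\ 0 < p.1, 0 < p.2 &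
  forall n (a : nat -> R) N, (0 < n)%N ->
  exists W, [/\ measurable W, pr W <= 2 * expR (- (n%:R * M)) &
    forall w j, (j < N)%N -> `|t - a j| < p.2 ->
      n%:R * (b + c2 * a j) <= Sn n (a j) w ->
      n%:R * (b + c2 * a j - c1 * p.1) <= Sn n (a j) w - Sn n p.1 w -> W w]].
  move=> t; have [tt|tt] := leP t0 t; last by exists (0, 0).
  have [s [s0 Ds]] := hD t tt; have [dl dl0 h] := local_bound s t M M0 Ds.
  by exists (s, dl).
have cpt := @segment_compact R t0 k0%:R.
rewrite compact_cover in cpt.
have [] := cpt R `[t0, k0%:R]%classic (fun t => ball t (f t).2).
- by move=> t; rewrite /= in_itv/= => /andP[tt _]; apply: ball_open; have [] := hf t tt.
- move=> t /= tI; exists t => //; apply: ballxx.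
  by move: tI; rewrite in_itv/= => /andP[tt _]; have [] := hf t tt.
move=> D' D'sub cov'.
exists (2 * (size (enum_fset D'))%:R + 1); first by rewrite ltr_wpDl// mulr_ge0.
move=> n a N n0.
have /choice[W0 hW0] : forall t : R, exists W, t0 <= t -> [/\ measurable W, pr W <= 2 * expR (- (n%:R * M)) &
    forall w j, (j < N)%N -> `|t - a j| < (f t).2 ->
      n%:R * (b + c2 * a j) <= Sn n (a j) w ->
      n%:R * (b + c2 * a j - c1 * (f t).1) <= Sn n (a j) w - Sn n (f t).1 w -> W w].
  move=> t; have [tt|tt] := leP t0 t; last by exists set0.
  by have [_ _ /(_ n a N n0)[W hW]] := hf t tt; exists W.
have [W1 [mW1 pW1 hW1]] := htail n a N n0.
have inD' (t : R) : t \in D' -> t0 <= t.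
  by move=> /D'sub; rewrite inE/= in_itv/= => /andP[].
pose E t := if t0 <= t then W0 t else set0.
have mE t : measurable (E t).
  by rewrite /E; case: ifPn => // tt; have [] := hW0 t tt.
pose U := \big[setU/set0]_(t <- enum_fset D') E t.
have mU : measurable U by apply: bigsetU_measurable.
exists (U `|` W1); split; first exact: measurableU.
  apply: le_trans (pr_setU _ _ _ mU mW1) _; rewrite [leRHS]mulrDl mul1r lerD//.
  apply: le_trans (pr_bigU P _ _ _ mE) _.
  apply: (@le_trans _ _ (\sum_(t <- enum_fset D') (2 * expR (- (n%:R * M))))).
    apply: ler_sum => t _; rewrite /E; case: ifPn => [tt|_]; first by have [] := hW0 t tt.
    by rewrite pr_set0 mulr_ge0// expR_ge0.
  by rewrite big_const_seq count_predT iter_addr_0 -mulr_natl; rewrite le_eqVlt; apply/orP; left; apply/eqP; ring.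
move=> w j jN ta h.
(* The first constraint of the pair is the case [s = 0]. *)
have h0 : n%:R * (b + c2 * a j) <= Sn n (a j) w.
  by have := h 0 (lexx _); rewrite Sn0 mulr0 !subr0.
have [aj|aj] := leP k0%:R (a j).
  right; apply: (hW1 w j jN aj); apply: le_trans h0; rewrite ler_wpM2l//.
  by rewrite lerDr ltW.
left; have [|t /= tD' tb] := cov' (a j); first by rewrite /= in_itv/= ta ltW.
rewrite /U -bigcup_seq; exists t => //=.
have tt := inD' t tD'; rewrite /E tt.
have [_ _ hw] := hW0 t tt; apply: (hw w j jN tb h0).
by apply: h; have [/ltW] := hf t tt.
Qed.

End covering.

(** * The overflow event *)

Section event.
Context {R : realType} (v : R -> R) {d} {T : measurableType d} (P : probability T R).
Variable A : nat -> R -> T -> R.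
Hypothesis v0 : v 0 = 0.
Hypothesis v_growth : exists alpha : R, alpha < 2 /\
      (fun t => v t / t `^ alpha) @ +oo --> (0 : R).
Hypothesis hA : iid_gaussian_copies P v A.
Variables b c1 c2 : R.
Hypotheses (hb : 0 < b) (hc2 : 0 < c2) (hc12 : c2 < c1).
Local Notation pr := (pr P).
Local Notation Sn := (Sn A).
Local Notation q := (@qseq R).

Lemma le_qseq (g : R -> R) (z : R) : continuous g ->
  (forall k, 0 < q k -> g (q k) <= z) -> forall t, 0 <= t -> g t <= z.
Proof.
move=> cg h t t0; rewrite leNgt; apply/negP => zt.
have oz : open [set y : R | z < y] by exact: open_gt.
have oU : open (g @^-1` [set y | z < y]) by apply: open_comp => // u _; exact: cg.
have [e /= e0 he] := (nbhs_ballP _ _).1 (open_nbhs_nbhs (conj oU zt)).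
have [||i [/= i0 iz]] := @qseq_dense R ([set u | 0 < u] `&` (g @^-1` [set y | z < y])).
- by apply: openI => //; exact: open_gt.
- exists (t + e / 2); split => /=; first by rewrite ltr_wpDl// divr_gt0.
  by apply: he; rewrite /ball/= opprD addNKr normrN gtr0_norm ?divr_gt0//; lra.
by have := h i i0; rewrite leNgt iz.
Qed.

Let net n (c t : R) w := Sn n t w - n%:R * c * t.

Let net_continuous n c w : continuous (fun t : R => net n c t w).
Proof.
move=> t; apply: (@cvgB _ R^o); first exact: (Sn_continuous v P A hA).
by apply: (@cvgM R^o); [exact: cvg_cst|exact: cvg_id].
Qed.

Let supnetE n c w : supnet (fun i t => A i t w) n c =
  ereal_sup [set (net n c t w)%:E | t in `]0, +oo[%classic].
Proof. by []. Qed.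

Definition overflow n : set T := [set w | ((n%:R * b)%:E < Q2 A n c1 c2 w)%E].

Definition overflow_at n (e : R) j : set T :=
  [set w | forall k, 0 < q k -> n%:R * b + e + net n c1 (q k) w <= net n c2 (q j) w].

(** The margin [1 / (m + 1)] turns the strict inequality between suprema into countably many weak
    ones at rational times, which yields measurability. *)
Lemma overflowE n : overflow n =
  \bigcup_(j in [set j | 0 < q j]) \bigcup_m overflow_at n m.+1%:R^-1 j.
Proof.
apply/seteqP; split => w.
  rewrite /overflow /Q2 /= !supnetE.
  set u2 := ereal_sup _; set u1 := ereal_sup _.
  have u1ge t : 0 < t -> ((net n c1 t w)%:E <= u1)%E.
    by move=> t0; apply: ereal_sup_ubound; exists t => //=; rewrite in_itv/= t0.
  (* An infinite second supremum makes [Q2] equal to [-oo] by convention, even against [+oo], so it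
     cannot occur on the event. *)
  case E1 : u1 => [r| |]; last 2 first.
  - by rewrite addeNy.
  - by have := u1ge 1 ltr01; rewrite E1 leeNy_eq.
  rewrite lteBrDr// => h.
  have [_ [t /= + <-]] := ereal_sup_gt h; rewrite in_itv/= andbT => t0.
  rewrite -EFinD lte_fin => ht.
  have oU : open ([set u : R | 0 < u] `&` ((fun u => net n c2 u w) @^-1` [set y | n%:R * b + r < y])).
    apply: openI; first exact: open_gt.
    by apply: open_comp; [move=> u _; exact: net_continuous|exact: open_gt].
  have [j [/= j0 hj]] := qseq_dense _ oU (ex_intro _ t (conj t0 ht)).
  exists j => //.
  set dl := net n c2 (q j) w - (n%:R * b + r).
  have dl0 : 0 < dl by rewrite subr_gt0.
  exists (Num.truncn dl^-1) => //= k k0.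
  have hr : net n c1 (q k) w <= r by have := u1ge _ k0; rewrite E1 lee_fin.
  have : (Num.truncn dl^-1).+1%:R^-1 <= dl.
    by rewrite invf_ple ?posrE// ltW//; exact: truncnS_gt.
  by move: (_.+1%:R^-1) => e; rewrite /dl; lra.
move=> [j /= j0 [m _ h]].
rewrite /overflow /Q2 /= !supnetE.
set z := net n c2 (q j) w - n%:R * b - m.+1%:R^-1.
have hz t : 0 <= t -> net n c1 t w <= z.
  apply: (le_qseq (fun t => net n c1 t w)); first exact: net_continuous.
  by move=> k k0; have := h k k0; rewrite /z; move: (m.+1%:R^-1) => e; lra.
apply: (@lt_le_trans _ _ ((net n c2 (q j) w)%:E - z%:E)%E).
  rewrite -EFinB lte_fin /z.
  have : 0 < m.+1%:R^-1 :> R by [].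
  by move: (m.+1%:R^-1) => e; lra.
apply: leeB; first by apply: ereal_sup_ubound; exists (q j) => //=; rewrite in_itv/= j0.
apply: ge_ereal_sup => _ [t /= + <-]; rewrite in_itv/= andbT lee_fin => t0.
exact/hz/ltW.
Qed.

Let mnet n c t : measurable_fun setT (fun w => net n c t w).
Proof. by apply: measurable_funB => //; exact: (measurable_Sn v P A hA). Qed.

Lemma measurable_overflow_at n e j : measurable (overflow_at n e j).
Proof.
have -> : overflow_at n e j = \bigcap_(k in [set k | 0 < q k])
   [set w | n%:R * b + e + net n c1 (q k) w <= net n c2 (q j) w].
  by apply/seteqP; split => w h k; exact: h.
apply: bigcap_measurableType => k _; rewrite -[X in measurable X]setTI.
apply: measurable_fun_le => //.
apply: measurable_funD => //.
Qed.

Lemma measurable_overflow n : measurable (overflow n).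
Proof.
rewrite overflowE; apply: bigcup_measurable => j _.
by apply: bigcupT_measurable => m; exact: measurable_overflow_at.
Qed.

Lemma overflow_bound M : 0 <= M ->
  (forall t, b / (c1 - c2) <= t -> exists s, [/\ 0 < s & dual_gt v b c1 c2 s t M]) ->
  exists2 C : R, 0 < C & forall n, (0 < n)%N -> pr (overflow n) <= C * expR (- (n%:R * M)).
Proof.
move=> M0 hD.
have c120 : 0 < c1 - c2 by rewrite subr_gt0.
have t00 : 0 <= b / (c1 - c2) by rewrite divr_ge0 ?ltW.
have [C C0 hC] := cover_bound v P A v0 v_growth hA b c1 c2 hb hc2 _ _ M0 t00 hD.
exists C => // n n0.
pose H j := if b / (c1 - c2) <= q j then overflow_at n 0 j else set0.
have mH j : measurable (H j).
  by rewrite /H; case: ifP => // _; exact: measurable_overflow_at.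
pose F N := \big[setU/set0]_(j < N.+1) H j.
have mF N : measurable (F N) by apply: bigsetU_measurable.
have sub : overflow n `<=` \bigcup_j H j.
  rewrite overflowE => w [j /= j0 [m _ h]]; exists j => //.
  have : 0 < m.+1%:R^-1 :> R by [].
  move: h; move: (m.+1%:R^-1) => e h em.
  have hz : net n c1 (q j) w <= net n c2 (q j) w - n%:R * b - e.
    apply: (le_qseq (fun t => net n c1 t w)); [exact: net_continuous| |exact: ltW].
    by move=> k k0; have := h k k0; lra.
  (* At the common time [q j] the two nets differ by [n (c1 - c2) (q j)], and this must be at least
     [n b]. *)
  have tj : b / (c1 - c2) <= q j.
    rewrite ler_pdivrMr//; move: hz; rewrite /net => hz.
    have : n%:R * b <= n%:R * (q j * (c1 - c2)) by lra.
    by rewrite ler_pM2l// ltr0n.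
  rewrite /H tj => k k0; have := h k k0; lra.
have hF N : pr (F N) <= C * expR (- (n%:R * M)).
  have [W [mW pW hW]] := hC n q N.+1 n0.
  apply: le_trans pW; apply: le_pr => //.
  rewrite /F -(big_mkord xpredT H) -bigcup_seq => w [j /=]; rewrite mem_index_iota => /andP[_ jN].
  rewrite /H; case: ifP => // tj h; apply: (hW w j jN tj) => s s0.
  have hz : net n c1 s w <= net n c2 (q j) w - n%:R * b.
    apply: (le_qseq (fun t => net n c1 t w)); [exact: net_continuous| |exact: s0].
    by move=> k k0; have := h k k0; lra.
  by move: hz; rewrite /net; lra.
(* The bound on [F N] is free of [N] and so survives in the increasing union. *)
have cF : pr (F N) @[N --> \oo] --> pr (\bigcup_j H j).
  have bF : \bigcup_N F N = \bigcup_j H j by exact: bigcup_bigsetU_bigcup.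
  rewrite -bF; apply: fine_cvg.
  rewrite -prE; last exact: bigcupT_measurable.
  apply: nondecreasing_cvg_mu => //; first exact: bigcupT_measurable.
  by apply/nondecreasing_seqP => N; rewrite subsetEset /F [X in _ `<=` X]big_ord_recr/=; exact: subsetUl.
apply: (@le_trans _ _ (pr (\bigcup_j H j))).
  apply: le_pr => //; first exact: measurable_overflow.
  exact: bigcupT_measurable.
by move/cvgr_to_le: cF; apply; exact: nearW.
Qed.

End event.

(** * Quadratic duality in the reproducing kernel space *)

Section quadratic.
Context {R : realType}.

Lemma discriminant_le (N B V : R) : (forall l, 0 <= N + 2 * l * B + l ^+ 2 * V) -> B ^+ 2 <= N * V.
Proof.
move=> h; have [V0|V0] := eqVneq V 0.
  rewrite V0 mulr0; have [->|B0] := eqVneq B 0; first by rewrite expr0n.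
  have := h (- (N + 1) / (2 * B)); rewrite V0 mulr0 addr0.
  have -> : 2 * (- (N + 1) / (2 * B)) * B = - (N + 1) by field.
  by lra.
have V1 : 0 < V.
  rewrite lt_neqAle eq_sym V0 /= leNgt; apply/negP => Vn.
  have h0 := h 0; rewrite mulr0 mul0r expr0n mul0r !addr0 in h0.
  have := h ((`|B| + N + 1) / (- V) + 1).
  set l := _ + 1.
  have l1 : 1 <= l by rewrite lerDr divr_ge0 ?addr_ge0// oppr_ge0 ltW.
  have lV : (`|B| + N + 1) < l * (- V) by rewrite /l mulrDl divfK ?oppr_eq0// mul1r; lra.
  have : B <= `|B| by exact: ler_norm.
  have lV2 : l * (`|B| + N + 1) <= l * (l * - V) by rewrite ler_wpM2l ?ltW//; lra.
  have := normr_ge0 B; have h2 := h 1; have h3 := h (-1).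
  nra.
have := h (- B / V).
have -> : N + 2 * (- B / V) * B + (- B / V) ^+ 2 * V = (N * V - B ^+ 2) / V by field.
by rewrite pmulr_lge0 ?invr_gt0// subr_ge0.
Qed.

(* Lagrangian duality for [min z K z] subject to [K z >= a] in the plane, by inspection of
   the possible active sets. *)
Lemma qp_duality (k11 k12 k22 a1 a2 M : R) : 0 <= k11 -> 0 <= k22 -> k12 ^+ 2 <= k11 * k22 ->
  0 < a1 ->
  (forall x y, 0 <= x -> 0 <= y ->
    x * a1 + y * a2 - (x ^+ 2 * k11 + 2 * x * y * k12 + y ^+ 2 * k22) / 2 <= M) ->
  exists x y, [/\ a1 <= x * k11 + y * k12, a2 <= x * k12 + y * k22 &
    x ^+ 2 * k11 + 2 * x * y * k12 + y ^+ 2 * k22 <= 2 * M].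
Proof.
move=> K11 K22 D a10 h.
(* Along a nonnegative direction of zero energy a positive gain would make the dual unbounded. *)
have unb x y : 0 <= x -> 0 <= y -> x ^+ 2 * k11 + 2 * x * y * k12 + y ^+ 2 * k22 = 0 ->
    x * a1 + y * a2 <= 0.
  move=> x0 y0 q0; rewrite leNgt; apply/negP => g0.
  have M0 : 0 <= M by have := h 0 0 (lexx _) (lexx _); lra.
  set g := _ + _ in g0; pose l := (M + 1) / g.
  have l0 : 0 <= l by rewrite divr_ge0 ?ltW//; lra.
  have := h (l * x) (l * y) (mulr_ge0 l0 x0) (mulr_ge0 l0 y0).
  have -> : (l * x) ^+ 2 * k11 + 2 * (l * x) * (l * y) * k12 + (l * y) ^+ 2 * k22 = l ^+ 2 * (x ^+ 2 * k11 + 2 * x * y * k12 + y ^+ 2 * k22) by ring.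
  rewrite q0 mulr0 mul0r subr0.
  have -> : l * x * a1 + l * y * a2 = l * g by rewrite /g; ring.
  by rewrite /l divfK ?gt_eqF//; lra.
have k110 : 0 < k11.
  rewrite lt_neqAle K11 andbT eq_sym; apply/eqP => k0.
  by have := unb 1 0 ler01 (lexx _); rewrite k0; lra.
(* Complementary slackness: where the linear term equals the energy, the dual value is half the
   energy. *)
have fin x y : 0 <= x -> 0 <= y -> x * a1 + y * a2 = x ^+ 2 * k11 + 2 * x * y * k12 + y ^+ 2 * k22 ->
    x ^+ 2 * k11 + 2 * x * y * k12 + y ^+ 2 * k22 <= 2 * M.
  by move=> x0 y0 e; have := h x y x0 y0; rewrite e; lra.
(* Only the first constraint is active. *)
have [c1|c1] := leP (a2 * k11) (a1 * k12).
  exists (a1 / k11), 0; split.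
  - by rewrite divfK ?gt_eqF// mul0r addr0.
  - by rewrite mul0r addr0 mulrAC ler_pdivlMr.
  - apply: fin => //; first by rewrite divr_ge0// ltW.
    by field; rewrite gt_eqF.
have k220 : 0 < k22.
  rewrite lt_neqAle K22 andbT eq_sym; apply/eqP => k0.
  have k120 : k12 = 0.
    by apply/eqP; rewrite -sqrf_eq0 eq_le sqr_ge0 andbT (le_trans D)// k0 mulr0.
  have a20 : 0 < a2 by move: c1; rewrite k120 mulr0 pmulr_lgt0.
  by have := unb 0 1 (lexx _) ler01; rewrite k0; lra.
(* Only the second constraint is active. *)
have [c2|c2] := leP (a1 * k22) (a2 * k12).
  have [a20|a20] := leP a2 0.
    exfalso.
    have k12n : k12 < 0.
      rewrite ltNge; apply/negP => k0; have : 0 < a1 * k22 by rewrite mulr_gt0.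
      by have := mulr_le0_ge0 a20 k0; lra.
    have e1 : a2 * k11 * k12 < a1 * k12 * k12 by rewrite ltr_nM2r.
    have e2 : a1 * k22 * k11 <= a2 * k12 * k11 by rewrite ler_wpM2r.
    have e3 : a1 * k12 ^+ 2 <= a1 * (k11 * k22) by rewrite ler_wpM2l// ltW.
    by move: e1 e2 e3; rewrite expr2; lra.
  exists 0, (a2 / k22); split.
  - by rewrite mul0r add0r mulrAC ler_pdivlMr.
  - by rewrite mul0r add0r divfK ?gt_eqF.
  - apply: fin => //; first by rewrite divr_ge0// ltW.
    by field; rewrite gt_eqF.
(* Both constraints are active: the multipliers solve the linear system, and the two failed tests
   are their positivity. *)
have [det|det] := ltP (k12 ^+ 2) (k11 * k22).
  have d0 : 0 < k11 * k22 - k12 ^+ 2 by rewrite subr_gt0.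
  have dn : k11 * k22 - k12 ^+ 2 != 0 by rewrite gt_eqF.
  pose x := (k22 * a1 - k12 * a2) / (k11 * k22 - k12 ^+ 2).
  pose y := (k11 * a2 - k12 * a1) / (k11 * k22 - k12 ^+ 2).
  have x0 : 0 <= x by rewrite divr_ge0 ?(ltW d0)//; lra.
  have y0 : 0 <= y by rewrite divr_ge0 ?(ltW d0)//; lra.
  have E1 : x * k11 + y * k12 = a1 by rewrite /x /y; field.
  have E2 : x * k12 + y * k22 = a2 by rewrite /x /y; field.
  exists x, y; split; [by rewrite E1|by rewrite E2|apply: fin => //].
  by rewrite -E1 -E2; ring.
(* Singular form: for [k12 <= 0] the kernel vector [(- k12, k11)] is nonnegative with positive gain;
   for [k12 > 0] the two failed tests multiply to a contradiction. *)
exfalso; have dE : k12 ^+ 2 = k11 * k22 by apply/eqP; rewrite eq_le D det.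
have [k0|k0] := leP k12 0.
  have nk : 0 <= - k12 by rewrite oppr_ge0.
  have := unb (- k12) k11 nk (ltW k110).
  have -> : (- k12) ^+ 2 * k11 + 2 * - k12 * k11 * k12 + k11 ^+ 2 * k22 =
    k11 * (k11 * k22 - k12 ^+ 2) by ring.
  by rewrite dE subrr mulr0 => /(_ erefl); lra.
have a20 : 0 < a2.
  by move: (lt_trans (mulr_gt0 a10 k0) c1); rewrite pmulr_lgt0.
have e1 : a1 * k12 * (a2 * k12) < a2 * k11 * (a1 * k22).
  by rewrite ltr_pM// mulr_ge0// ltW.
have : a1 * a2 * k12 ^+ 2 < a1 * a2 * (k11 * k22) by move: e1; rewrite expr2; lra.
by rewrite dE ltxx.
Qed.

End quadratic.

(** * The span of the kernel functions: regularity, translation, feasible paths *)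

Section rkhs.
Context {R : realType} (v : R -> R).
Hypothesis v_cont : {within `[0, +oo[, continuous v}.
Hypothesis v_ge0 : forall t, 0 <= t -> 0 <= v t.
Hypothesis v0 : v 0 = 0.
Hypothesis v_growth : exists alpha : R, alpha < 2 /\
      (fun t => v t / t `^ alpha) @ +oo --> (0 : R).
Hypothesis psd : forall h, 0 <= span_norm2 v h.
Implicit Types h g : seq (R * R).
Local Notation scal := (scal R).
Local Notation gcov := (cov R (Gam v)).
Let Gsym := Gam_sym v.

Let norm2E h : span_norm2 v h = gcov h h. Proof. by []. Qed.

Let evalE h x : span_eval v h x = gcov h [:: (1, x)].
Proof.
by rewrite /span_eval /cov; apply: eq_bigr => p _; rewrite big_cons big_nil addr0 /= mulr1.
Qed.

Let covs := (cov_catl R (Gam v), cov_scall R (Gam v), cov_catr R (Gam v), cov_scalr R (Gam v) Gsym).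

Lemma span_eval_scal c h x : span_eval v (scal c h) x = c * span_eval v h x.
Proof. by rewrite !evalE cov_scall. Qed.

Lemma span_norm2_scal c h : span_norm2 v (scal c h) = c ^+ 2 * span_norm2 v h.
Proof. by rewrite !norm2E !covs mulrA. Qed.

Lemma Gam0r s : Gam v s 0 = 0.
Proof. by rewrite /Gam sub0r normrN normr0 v0; ring. Qed.

Lemma span_eval0 h : span_eval v h 0 = 0.
Proof. by rewrite /span_eval big1// => p _; rewrite Gam0r mulr0. Qed.

(** By the reproducing property the increment is the inner product of [h] with
    [Gam(x, .) - Gam(y, .)], whose squared norm is [v |x - y|]. On bounded sets of paths this is a
    common modulus of continuity. *)
Lemma span_cauchy_schwarz h x y :
  (span_eval v h x - span_eval v h y) ^+ 2 <= span_norm2 v h * v `|x - y|.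
Proof.
pose dxy : seq (R * R) := [:: (1, x)] ++ scal (-1) [:: (1, y)].
have E1 : span_eval v h x - span_eval v h y = gcov h dxy.
  by rewrite !evalE !covs mulN1r.
have E2 : gcov dxy dxy = v `|x - y|.
  have s1 a b : gcov [:: (1, a)] [:: (1, b)] = Gam v a b.
    by rewrite /cov !(big_cons, big_nil) /= !addr0 !mul1r.
  rewrite /dxy !covs !s1 /Gam !subrr normr0 v0 (distrC y x).
  by field.
rewrite E1 -E2 norm2E; clearbody dxy; apply: discriminant_le => l.
have := psd (h ++ scal l dxy); rewrite norm2E !covs (cov_sym R (Gam v) Gsym dxy h).
by move=> H; apply: le_trans H _; rewrite le_eqVlt; apply/orP; left; apply/eqP; ring.
Qed.

Lemma Gam_cauchy_schwarz s t : (Gam v s t) ^+ 2 <= v `|s| * v `|t|.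
Proof.
have := span_cauchy_schwarz [:: (1, s)] t 0; rewrite span_eval0 !subr0.
rewrite /span_eval big_cons big_nil addr0 /= mul1r.
rewrite /span_norm2 !big_cons !big_nil /= !addr0 !mul1r.
by rewrite (Gam_diag v v0).
Qed.

Let vabs_cont : continuous (fun t : R => v `|t|).
Proof.
have /continuous_within_itvcyP[c0 c1] := v_cont; move=> t.
have [->|t0] := eqVneq t 0; last first.
  apply: (@continuous_comp _ _ _ (fun t : R => `|t|) v); first exact: norm_continuous.
  by apply: c0; rewrite in_itv/= andbT normr_gt0.
apply/cvgrPdist_lt => e e0.
move/cvgrPdist_lt: c1 => /(_ e e0); rewrite near_withinE => /nbhs_ballP[r /= r0 hr].
apply/nbhs_ballP; exists r => //= x; rewrite /ball/= sub0r normrN => xr.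
rewrite normr0; have [->|x0] := eqVneq x 0; first by rewrite normr0 subrr normr0.
by apply: hr; rewrite ?normr_gt0// /ball/= sub0r normrN normr_id.
Qed.

Lemma v_small0 e : 0 < e -> exists2 dl : R, 0 < dl & forall u, 0 <= u <= dl -> v u <= e.
Proof.
move=> e0; have /cvgrPdist_lt /(_ e e0) /nbhs_ballP[r /= r0 hr] := vabs_cont 0.
exists (r / 2); first by rewrite divr_gt0.
move=> u /andP[u0 ur]; have := hr u; rewrite /ball/= sub0r normrN (ger0_norm u0) normr0 v0 sub0r normrN.
move=> /(_ _)/ltW h; apply: le_trans (ler_norm _) (h _).
lra.
Qed.

Lemma Gam_continuous s : continuous (Gam v s).
Proof.
move=> t; apply: (@cvgM R^o); last exact: cvg_cst.
apply: (@cvgB _ R^o).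
  by apply: (@cvgD _ R^o); [exact: cvg_cst|exact: vabs_cont].
apply: (@continuous_comp _ _ _ (fun t : R => t - s) (fun t : R => v `|t|)); last exact: vabs_cont.
by apply: (@cvgB _ R^o); [exact: cvg_id|exact: cvg_cst].
Qed.

Lemma v_little_sqr e : 0 < e -> exists2 B : R, 0 < B & forall t, B <= t -> v t <= e * t ^+ 2.
Proof.
move=> e0; have [al [al2 vg]] := v_growth.
have [B [_ hB]] : \forall t \near +oo, v t / t `^ al < e.
  by have := vg; move=> /cvgrPdist_lt /(_ e e0); apply: filterS => t; rewrite sub0r normrN; exact: le_lt_trans (ler_norm _).
exists (`|B| + 1) => [|t Bt]; first by rewrite ltr_wpDl.
have t1 : 1 <= t by have := normr_ge0 B; lra.
have tB : B < t by have := ler_norm B; lra.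
have t0 : 0 < t by lra.
have := hB t tB; rewrite ltr_pdivrMr ?powR_gt0// => /ltW h; apply: le_trans h _.
rewrite ler_wpM2l ?(ltW e0)// -powR_mulrn ?(ltW t0)// ler_powR// ltW//.
Qed.

(** The square of [Gam v s t] is at most [v |s| v |t|], and [v] is of smaller order than the
    square. *)
Lemma Gam_growth s e : 0 < e ->
  exists2 B : R, 0 < B & forall t, B <= `|t| -> `|Gam v s t / (1 + `|t|)| <= e.
Proof.
move=> e0; have vs0 : 0 <= v `|s| by exact: v_ge0.
pose k := e ^+ 2 / (v `|s| + 1).
have k0 : 0 < k by rewrite divr_gt0 ?exprn_gt0// ltr_wpDl.
have [B B0 hB] := v_little_sqr k k0.
exists B => // t Bt; have vt := hB _ Bt.
have t0 := normr_ge0 t.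
rewrite normrM normfV (ger0_norm (addr_ge0 ler01 t0)) ler_pdivrMr ?ltr_wpDr//.
apply: (@le_trans _ _ (e * `|t|)); last by rewrite ler_wpM2l ?(ltW e0)//; lra.
have et : 0 <= e * `|t| by rewrite mulr_ge0// ltW.
rewrite -(ger0_norm et) -ler_sqr ?nnegrE// !real_normK ?num_real//.
apply: le_trans (Gam_cauchy_schwarz s t) _.
apply: (@le_trans _ _ (v `|s| * (k * `|t| ^+ 2))); first by rewrite ler_wpM2l.
rewrite exprMn mulrA ler_wpM2r ?sqr_ge0// /k mulrCA ger_pMr ?exprn_gt0//.
by rewrite ler_pdivrMr ?mul1r ?ltr_wpDl//; lra.
Qed.

Lemma span_eval_Omega h : in_Omega (span_eval v h).
Proof.
have consE p g : span_eval v (p :: g) = (fun t => p.1 * Gam v p.2 t + span_eval v g t).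
  by apply/funext => t; rewrite /span_eval big_cons.
have nilE : span_eval v [::] = (fun=> 0) by apply/funext => t; rewrite /span_eval big_nil.
split; last split; [|exact: span_eval0|].
  elim: h => [|p g IH]; first by rewrite nilE => t; exact: cvg_cst.
  rewrite consE => t; apply: (@cvgD _ R^o); last exact: IH.
  by apply: (@cvgM R^o); [exact: cvg_cst|exact: Gam_continuous].
have lim (F : set_system R) : Filter F -> (forall B : R, \forall t \near F, B <= `|t|) ->
    (fun t => span_eval v h t / (1 + `|t|)) @ F --> 0.
  move=> FF hF; elim: h => [|p g IH].
    by rewrite nilE; under eq_fun do rewrite mul0r; exact: cvg_cst.
  rewrite consE; under eq_fun do rewrite mulrDl -mulrA.
  suff : (fun t => p.1 * (Gam v p.2 t / (1 + `|t|)) + span_eval v g t / (1 + `|t|)) @ F -->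
    p.1 * 0 + 0 by rewrite mulr0 addr0.
  apply: (@cvgD _ R^o) => //; apply: (@cvgM R^o); first exact: cvg_cst.
  apply/cvgrPdist_le => e e0; have [B _ hB] := Gam_growth p.2 e e0.
  by apply: filterS (hF B) => t Bt; rewrite sub0r normrN; exact: hB.
split; apply: lim.
- move=> B; near=> t; apply: le_trans (ler_norm _).
  by near: t; apply: nbhs_pinfty_ge; rewrite num_real.
- move=> B; near=> t; rewrite -normrN; apply: le_trans (ler_norm _).
  by rewrite lerNr; near: t; apply: nbhs_ninfty_le; rewrite num_real.
Unshelve. all: by end_near. Qed.

Lemma rate_span h : (rate v (span_eval v h) <= (span_norm2 v h / 2)%:E)%E.
Proof.
apply: ereal_inf_lbound; exists (span_norm2 v h) => //.
exists (fun=> h); split; last by split => [t|]; exact: cvg_cst.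
move=> e e0; exists 0%N => _ _ _ _.
have -> : span_sub h h = h ++ scal (-1) h.
  by congr (_ ++ _); apply: eq_map => p; rewrite mulN1r.
rewrite norm2E !covs; apply: le_lt_trans e0.
by rewrite le_eqVlt; apply/orP; left; apply/eqP; ring.
Qed.

(** The path [x |-> h(x + dl) - h(dl)], again in the span: each [Gam(a, .)] becomes
    [Gam(a - dl, .) - Gam(- dl, .)]. Stationarity makes this an isometry. *)
Definition shift (dl : R) h := [seq (p.1, p.2 - dl) | p <- h] ++ scal (-1) [seq (p.1, - dl) | p <- h].

Let Gam_shift dl a x : Gam v (a - dl) x - Gam v (- dl) x = Gam v a (x + dl) - Gam v a dl.
Proof.
rewrite /Gam; have -> : x - (a - dl) = x + dl - a by ring.
have -> : x - - dl = x + dl by ring.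
by rewrite normrN -(distrC dl a); field.
Qed.

Lemma span_eval_shift dl h x :
  span_eval v (shift dl h) x = span_eval v h (x + dl) - span_eval v h dl.
Proof.
rewrite evalE /shift !covs -!evalE mulN1r /span_eval !big_map -!sumrB.
by apply: eq_bigr => p _ /=; rewrite -!mulrBr Gam_shift.
Qed.

Lemma span_norm2_shift dl h : span_norm2 v (shift dl h) = span_norm2 v h.
Proof.
have E g : gcov (shift dl h) g = \sum_(q <- g) q.1 * (span_eval v h (q.2 + dl) - span_eval v h dl).
  rewrite (cov_sym R (Gam v) Gsym) /cov; apply: eq_bigr => q _.
  rewrite -span_eval_shift /span_eval mulr_sumr; apply: eq_bigr => p _.
  by rewrite Gsym; ring.
rewrite norm2E E /shift big_cat /= !big_map /=.
rewrite norm2E /cov -big_split; apply: eq_bigr => p _ /=.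
rewrite subrK (addNr dl) span_eval0 mulN1r mulNr -mulrBr.
have -> : span_eval v h p.2 - span_eval v h dl - (0 - span_eval v h dl) = span_eval v h p.2 by ring.
rewrite /span_eval mulr_sumr; apply: eq_bigr => q _.
by rewrite Gsym; ring.
Qed.

Section feasibility.
Variables b c1 c2 : R.
Hypotheses (hb : 0 < b) (hc2 : 0 < c2) (hc12 : c2 < c1).

Definition feasible (s t M : R) := exists h, [/\ b + c2 * t <= - span_eval v h (- t),
  b + c2 * t - c1 * s <= span_eval v h (- s) - span_eval v h (- t) & span_norm2 v h <= 2 * M].

Lemma feasible_rate s t M : feasible s t M ->
  (ereal_inf [set rate v f | f in Ust b c1 c2 s t] <= M%:E)%E.
Proof.
move=> [h [h1 h2 h3]]; apply: (@le_trans _ _ (rate v (span_eval v h))).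
  by apply: ereal_inf_lbound; exists (span_eval v h) => //; split; [exact: span_eval_Omega|].
apply: le_trans (rate_span h) _; rewrite lee_fin; lra.
Qed.

Lemma dual_feasible (s t M : R) : 0 < t -> ~ dual_gt v b c1 c2 s t M -> feasible s t M.
Proof.
move=> t0 nD.
pose g := Gam v t t; pose gs := Gam v s t; pose gg := Gam v s s.
have pv x y : pair_var v s t x y = x ^+ 2 * g + 2 * x * y * (g - gs) + y ^+ 2 * (g - 2 * gs + gg).
  by rewrite /pair_var -/g -/gs -/gg; ring.
have n2 x y : span_norm2 v [:: (- (x + y), - t); (y, - s)] = pair_var v s t x y.
  rewrite /span_norm2 !big_cons !big_nil /= !GamN (Gsym t s) /pair_var.
  by rewrite -/g -/gs -/gg; ring.
have pos x y : 0 <= x ^+ 2 * g + 2 * x * y * (g - gs) + y ^+ 2 * (g - 2 * gs + gg).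
  by rewrite -pv -n2.
(* The matrix entries are the covariances of [A(-t, 0)] and [A(-t, 0) - A(-s, 0)], the two
   constrained quantities. *)
have [] := @qp_duality R g (g - gs) (g - 2 * gs + gg) (b + c2 * t) (b + c2 * t - c1 * s) M.
- by have := pos 1 0; lra.
- by have := pos 0 1; lra.
- rewrite (mulrC g); apply: discriminant_le => l.
  by have := pos l 1; lra.
- by rewrite addr_gt0// mulr_gt0.
- move=> x y x0 y0; rewrite leNgt; apply/negP => h; apply: nD; exists x, y.
  by split => //; rewrite pv.
move=> x [y [E1 E2 E3]]; exists [:: (- (x + y), - t); (y, - s)].
rewrite /span_eval !big_cons !big_nil /= !GamN (Gsym t s) -/g -/gs -/gg.
split; [lra|lra|by rewrite n2 pv].
Qed.

(** Note [b + c2 t0 = c1 t0]. Translating by [dl] a path feasible for [(s - dl, t0)] gains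
    [(c1 - c2) dl] in the second constraint; in the first it loses at most an oscillation and
    [c2 dl], which a factor [l > 1] repairs at the price [l^2] in the norm. One [dl] serves all [s],
    since [span_cauchy_schwarz] bounds oscillations by the norm alone. *)
Lemma feasible_limit (M M' : R) : 0 <= M -> M < M' ->
  (forall s, 0 < s -> s < b / (c1 - c2) -> feasible s (b / (c1 - c2)) M) ->
  exists2 t, b / (c1 - c2) < t & forall s, 0 < s -> s < t -> feasible s t M'.
Proof.
set t0 := b / (c1 - c2) => M0 MM' hf.
have c120 : 0 < c1 - c2 by rewrite subr_gt0.
have t00 : 0 < t0 by rewrite divr_gt0.
have bE : b = (c1 - c2) * t0 by rewrite /t0 mulrC divfK// gt_eqF.
have M'0 : 0 < M' by lra.
have [l l1 lM] : exists2 l : R, 1 < l & l ^+ 2 * M <= M'.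
  (* With [l = 1 + u] one has [M = M' (1 - 4 u)], and [(1 + u)^2 (1 - 4 u) <= 1]. *)
  exists (1 + (M' - M) / (4 * M')).
    by rewrite ltrDl divr_gt0 ?mulr_gt0// subr_gt0.
  set u := (M' - M) / _.
  have u0 : 0 < u by rewrite divr_gt0 ?mulr_gt0// subr_gt0.
  have uE : u * (4 * M') = M' - M by rewrite divfK// gt_eqF// mulr_gt0.
  clearbody u; have -> : M = M' * (1 - 4 * u) by lra.
  rewrite -subr_ge0 (_ : _ - _ = M' * (2 * u + 7 * u ^+ 2 + 4 * u ^+ 3)); last by ring.
  by rewrite mulr_ge0 ?(ltW M'0)// !addr_ge0// mulr_ge0// ?exprn_ge0// ltW.
have c10 : 0 < c1 by exact: lt_trans hc2 hc12.
(* Up to two oscillations occur: after scaling, [2 l rho] uses half of the gain [(l - 1) c1 t0], and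
   the bound on [dl] below reserves the other half for [c2 dl]. *)
pose rho := (l - 1) * c1 * t0 / (4 * l).
have l0 : 0 < l by lra.
have num : 0 < (l - 1) * c1 * t0 by rewrite -subr_gt0 in l1; exact: (mulr_gt0 (mulr_gt0 l1 c10) t00).
have rho0 : 0 < rho by rewrite divr_gt0// mulr_gt0.
have rhoE : 4 * (l * rho) = (l - 1) * c1 * t0.
  by rewrite /rho; field; rewrite gt_eqF.
have e0 : 0 < rho ^+ 2 / (2 * M + 1) by rewrite divr_gt0 ?exprn_gt0//; lra.
have [d0 d00 hd0] := v_small0 _ e0.
have osc h x y : span_norm2 v h <= 2 * M -> `|x - y| <= d0 ->
    `|span_eval v h x - span_eval v h y| <= rho.
  move=> hM xy; rewrite -(ger0_norm (ltW rho0)) -ler_sqr ?nnegrE// !real_normK ?num_real//.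
  apply: le_trans (span_cauchy_schwarz h x y) _.
  have v1 : v `|x - y| <= rho ^+ 2 / (2 * M + 1) by apply: hd0; rewrite normr_ge0.
  have vv : 0 <= v `|x - y| by exact: v_ge0.
  apply: (@le_trans _ _ (2 * M * (rho ^+ 2 / (2 * M + 1)))).
    by apply: ler_pM => //; exact: psd.
  rewrite mulrCA ger_pMr ?exprn_gt0// ler_pdivrMr ?mul1r; lra.
pose dl := Num.min d0 ((l - 1) * c1 * t0 / (2 * c2)).
have dl0 : 0 < dl by rewrite lt_min d00 divr_gt0// mulr_gt0.
have dld0 : dl <= d0 by rewrite ge_min lexx.
have dlc : 2 * (c2 * dl) <= (l - 1) * c1 * t0.
  rewrite mulrA mulrC -ler_pdivlMr ?mulr_gt0//.
  by rewrite ge_min lexx orbT.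
have normM h : span_norm2 v h <= 2 * M -> span_norm2 v (scal l h) <= 2 * M'.
  by move=> hM; rewrite span_norm2_scal; have := ler_wpM2l (sqr_ge0 l) hM; lra.
exists (t0 + dl); first by rewrite ltrDl.
move=> s s0 st.
have [sdl|sdl] := leP s dl.
  (* For [s <= dl] the time [s - dl] is not positive; any path feasible at [t0] serves, since its
     value at [- s] is at most [rho] in size. The choice [t0 / 2] is arbitrary. *)
  have [||h [h1 h2 h3]] := hf (t0 / 2); [by rewrite divr_gt0|by lra|].
  exists (scal l h); rewrite !span_eval_scal; split; last exact: normM.
    have := osc h (- (t0 + dl)) (- t0) h3.
    have -> : `|- (t0 + dl) - - t0| = dl by rewrite (_ : _ - _ = - dl) ?normrN ?gtr0_norm//; ring.
    move=> /(_ dld0); rewrite ler_norml => /andP[_ lo].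
    have k1 : l * (c1 * t0 - rho) <= l * (- span_eval v h (- (t0 + dl))).
      by rewrite ler_pM2l//; move: h1; rewrite {1}bE; lra.
    by move: k1; rewrite {1}bE; lra.
  have := osc h (- (t0 + dl)) (- t0) h3.
  have -> : `|- (t0 + dl) - - t0| = dl by rewrite (_ : _ - _ = - dl) ?normrN ?gtr0_norm//; ring.
  move=> /(_ dld0); rewrite ler_norml => /andP[_ lo].
  have := osc h (- s) 0 h3; rewrite subr0 normrN (gtr0_norm s0) span_eval0 subr0.
  move=> /(_ (le_trans sdl dld0)); rewrite ler_norml => /andP[lo2 _].
  have k1 : l * (c1 * t0 - 2 * rho) <= l * (span_eval v h (- s) - span_eval v h (- (t0 + dl))).
    by rewrite ler_pM2l//; move: h1; rewrite {1}bE; lra.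
  have k2 : 0 < c1 * s by rewrite mulr_gt0.
  by move: k1; rewrite {1}bE; lra.
have [||h [h1 h2 h3]] := hf (s - dl); [by lra|by lra|].
exists (scal l (shift dl h)); rewrite !span_eval_scal !span_eval_shift; split; last first.
- by apply: normM; rewrite span_norm2_shift.
- have -> : - (t0 + dl) + dl = - t0 by ring.
  have -> : - s + dl = - (s - dl) by ring.
  rewrite -mulrBr.
  have k0 : 0 < c1 * (t0 + dl - s) by rewrite mulr_gt0// subr_gt0.
  have k1 : c1 * (t0 + dl - s) <= span_eval v h (- (s - dl)) - span_eval v h (- t0).
    by move: h2; rewrite {1}bE; lra.
  have k2 : 1 * (c1 * (t0 + dl - s)) <= l * (c1 * (t0 + dl - s)) by rewrite ler_pM2r// ltW.
  have k3 := ler_wpM2l (ltW l0) k1.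
  have k4 : 0 < (c1 - c2) * dl by rewrite mulr_gt0.
  have -> : span_eval v h (- (s - dl)) - span_eval v h dl - (span_eval v h (- t0) - span_eval v h dl) =
    span_eval v h (- (s - dl)) - span_eval v h (- t0) by ring.
  by rewrite {1}bE; lra.
- have -> : - (t0 + dl) + dl = - t0 by ring.
  have := osc h dl 0 h3; rewrite subr0 (gtr0_norm dl0) span_eval0 subr0 => /(_ dld0).
  rewrite ler_norml => /andP[lo _].
  have k1 : l * (c1 * t0 - rho) <= l * (- (span_eval v h (- t0) - span_eval v h dl)).
    by rewrite ler_pM2l//; move: h1; rewrite {1}bE; lra.
  by move: k1; rewrite {1}bE; lra.
Qed.

End feasibility.
End rkhs.

(** * Passage to the exponential rate *)

Section conclusion.
Context {R : realType}.
Local Open Scope ereal_scope.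

Lemma le_ereal_of_real (x y : \bar R) : (forall M : R, M%:E < x -> M%:E <= y) -> x <= y.
Proof.
case: x => [r| |]; case: y => [s| |] h; rewrite ?leey ?leNye//.
- rewrite lee_fin leNgt; apply/negP => sr.
  have := h ((r + s) / 2)%R; rewrite lte_fin lee_fin => /(_ _); lra.
- by have := h (r - 1)%R; rewrite lte_fin leeNy_eq => /(_ _); apply; lra.
- by have := h (s + 1)%R (ltry _); rewrite lee_fin gerDl ler10.
- by have := h 0%R (ltry _); rewrite leeNy_eq.
Qed.

Lemma elog_le (r C M : R) n : (0 < C)%R -> (r <= C * expR (- (n.+1%:R * M)))%R ->
  (n.+1%:R^-1)%:E * elog r%:E <= (n.+1%:R^-1 * ln C - M)%:E.
Proof.
move=> C0 rC; rewrite /elog; case: ifP => r0; last first.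
  by rewrite gt0_muleNy ?leNye// lte_fin.
have : (ln r <= ln C - n.+1%:R * M)%R.
  have : (ln r <= ln (C * expR (- (n.+1%:R * M))))%R by rewrite ler_ln ?posrE ?mulr_gt0 ?expR_gt0.
  by rewrite lnM ?posrE ?expR_gt0// expRK.
move=> h; rewrite -EFinM lee_fin.
have -> : (n.+1%:R^-1 * ln C - M = n.+1%:R^-1 * (ln C - n.+1%:R * M))%R by rewrite mulrBr mulKf.
by rewrite ler_pM2l.
Qed.

End conclusion.

Lemma span_norm2_ge0 (R : realType) (v : R -> R) (d : measure_display) (T : measurableType d)
    (P : probability T R) (A : nat -> R -> T -> R) : iid_gaussian_copies P v A ->
  forall h, 0 <= span_norm2 v h.
Proof.
move=> hA h.
have := cov_ge0 P _ _ _ (gA v P A hA) (Kiid_sym v) [seq (p.1, (0%N, p.2)) | p <- h].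
by rewrite /cov big_map; under eq_bigr do rewrite big_map.
Qed.

Theorem theorem3p2 (R : realType) (v : R -> R)
  (v_cont : {within `[0, +oo[, continuous v})
  (v_ge0 : forall t, 0 <= t -> 0 <= v t) (v0 : v 0 = 0)
  (v_growth : exists alpha : R, alpha < 2 /\
      (fun t => v t / t `^ alpha) @ +oo --> (0 : R))
  (d : measure_display) (T : measurableType d) (P : probability T R)
  (A : nat -> R -> T -> R) (hA : iid_gaussian_copies P v A)
  (b c1 c2 : R) (hb : 0 < b) (hc2 : 0 < c2) (hc12 : c2 < c1)
  (J : \bar R)
  (hJ : (fun n : nat => ((n.+1%:R)^-1)%:E *
          elog (P [set w | ((n.+1)%:R * b)%:E < Q2 A n.+1 c1 c2 w]))%E
        @ \oo --> (- J)%E) :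
  let t0 := b / (c1 - c2) in
  (ereal_inf [set ereal_sup [set ereal_inf [set rate v f | f in Ust b c1 c2 s t]
                             | s in `]0%R, t[%classic]
              | t in `]t0, +oo[%classic] <= J)%E.
Proof.
cbv zeta; set t0 := b / (c1 - c2); set V := ereal_inf _.
have psd := span_norm2_ge0 R v d T P A hA.
have t00 : 0 < t0 by rewrite divr_gt0// subr_gt0.
have bound (M : R) : (M%:E < V)%E -> exists2 C : R, 0 < C &
    forall n, (0 < n)%N -> pr P (overflow A b c1 c2 n) <= C * expR (- (n%:R * M)).
  (* For negative [M] the bound exceeds 1. *)
  move=> MV; have [M0|M0] := leP 0 M; last first.
    exists 1 => // n _; rewrite mul1r (@le_trans _ _ 1)//.
      by apply: pr_le1; exact: (measurable_overflow v P A hA).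
    by rewrite -[leLHS]expR0 ler_expR oppr_ge0 mulr_ge0_le0// ltW.
  apply: (overflow_bound v P A v0 v_growth hA b c1 c2 hb hc2 hc12) => //.
  have Vle (t M' : R) : t0 < t -> (forall s, 0 < s -> s < t -> feasible v b c1 c2 s t M') ->
      (V <= M'%:E)%E.
    move=> tt hf; apply: (@le_trans _ _ (ereal_sup [set ereal_inf [set rate v f | f in Ust b c1 c2 s t]
                             | s in `]0%R, t[%classic])).
      by apply: ereal_inf_lbound; exists t => //=; rewrite in_itv/= tt.
    apply: ge_ereal_sup => _ [s /= + <-]; rewrite in_itv/= => /andP[s0 st].
    by apply: feasible_rate => //; exact: hf.
  (* If no [s] has dual value above [M], every [s < t] is feasible at level [M], whence [V <= M]. At
     [t = t0] the room between [M] and [V] is spent on passing to some [t' > t0]. *)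
  move=> t; rewrite -/t0 le_eqVlt => /predU1P[<-|tt]; apply: contrapT => nD.
    have [M' MM' M'V] : exists2 M' : R, M < M' & (M'%:E < V)%E.
      move: MV; move: (V) => [r| |] // h; last by exists (M + 1); rewrite ?ltry// ltrDl.
      by exists ((M + r) / 2); move: h; rewrite !lte_fin; lra.
    have [|t' tt' hf] := feasible_limit v v_cont v_ge0 v0 psd b c1 c2 hb hc2 hc12 M M' M0 MM'.
    - move=> s s0 st; apply: (dual_feasible v psd) => // D.
      by apply: nD; exists s.
    - by move: M'V; rewrite ltNge (Vle t' M').
  move: MV; rewrite ltNge (Vle t M)// => s s0 st.
  apply: (dual_feasible v psd) => //; first exact: lt_trans tt.
  by move=> D; apply: nD; exists s.
(* Testing against real [M < V] also covers an infinite [V]. *)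
apply: le_ereal_of_real => M MV; have [C C0 hC] := bound M MV.
have hw : (n.+1%:R^-1 * ln C - M)%:E @[n --> \oo] --> (- M)%:E.
  apply/fine_cvgP; split; first exact: nearW.
  suff : (fun n : nat => n.+1%:R^-1 * ln C - M) @ \oo --> 0 * ln C - M by rewrite mul0r sub0r.
  apply: (@cvgB _ R^o); last exact: cvg_cst.
  by apply: (@cvgM R^o); [exact: cvg_harmonic|exact: cvg_cst].
suff : (- J <= (- M)%:E)%E by rewrite EFinN leeN2.
rewrite -(cvg_lim _ hJ)// -(cvg_lim _ hw)//; apply: lee_lim.
- by apply/cvg_ex; exists (- J)%E.
- by apply/cvg_ex; exists (- M)%:E.
apply: nearW => n.
have -> : [set w | ((n.+1)%:R * b)%:E < Q2 A n.+1 c1 c2 w]%E = overflow A b c1 c2 n.+1 by [].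
rewrite prE; last exact: (measurable_overflow v P A hA).
by apply: elog_le => //; exact: hC.
Qed.
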